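(* Every GaTEx graph $G$ has twin-width at most $1$. In particular, for a GaTEx graph $G$, $\mathrm{tww}(G)=1$ if and only if $G$ is not a cograph.
   Context: All graphs are finite, simple and undirected. A cograph is a graph with no induced path on four vertices. A galled-tree on a finite nonempty set $X$ is a directed acyclic graph $N=(V,E)$ such that either $V=X=\{x\}$ and $E=\emptyset$, or: (N1) there is a unique root with indegree 0 and outdegree at least 2; (N2) $x\in X$ iff $x$ has outdegree 0 and indegree 1; (N3) every non-root $v\in V\setminus X$ has either indegree 1 and outdegree at least 2, or indegree 2 and outdegree at least 1 (hybrid-vertex); (N4) each biconnected component $C$ of $N$ contains at most one hybrid-vertex whose two in-neighbours both belong to $C$. For $x,y\in X$, $\mathrm{lca}_N(x,y)$ is the (unique) minimal common ancestor of $x,y$. A labeled galled-tree $(N,t)$ has $t:V\to\{0,1,\odot\}$ with $t(x)=\odot$ iff $x\in X$; it explains the graph on $X$ where $\{x,y\}$ is an edge iff $t(\mathrm{lca}_N(x,y))=1$. A graph is GaTEx if it is isomorphic to a graph explained by some labeled galled-tree. Twin-width: a trigraph is a graph whose edges are partitioned into black and red edges; red degree is degree in the red edges. Contracting $u,v$ yields a new vertex $w$ replacing them, where for each other vertex $x$: $\{w,x\}$ is black if $\{u,x\}$ and $\{v,x\}$ are both black, absent if neither is an edge, and red otherwise. A graph on $n$ vertices (all edges black) is $d$-collapsible if there is a sequence of contractions $G=G_n,\dots,G_1$ to a single vertex with every $G_i$ of maximum red degree at most $d$; $\mathrm{tww}(G)$ is the least such $d$. *)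

(* Defs.v *)
From mathcomp Require Import all_boot.
Set Implicit Arguments.
Unset Strict Implicit.
Unset Printing Implicit Defensive.

Record sgraph := SGraph {
  svertex :> finType;
  sedge : rel svertex;
  sedge_sym : symmetric sedge;
  sedge_irr : irreflexive sedge
}.

Definition sg_iso (G H : sgraph) : Prop :=
  exists2 f : G -> H, bijective f & forall x y, sedge (f x) (f y) = sedge x y.

Definition induced_P4 (G : sgraph) : Prop :=
  exists2 f : 'I_4 -> G, injective f &
    forall i j : 'I_4, sedge (f i) (f j) = (i.+1 == j) || (j.+1 == i).

Definition cograph (G : sgraph) : Prop := ~ induced_P4 G.

Section Digraphs.
Variables (V : finType) (E : rel V).

Definition acyclic : Prop := forall s : seq V, cycle E s -> s = [::].

Definition indeg (v : V) : nat := #|[set u | E u v]|.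
Definition outdeg (v : V) : nat := #|[set w | E v w]|.

Definition is_root (v : V) : bool := indeg v == 0.
Definition hybrid (v : V) : bool := (indeg v == 2) && (1 <= outdeg v).

Definition uedge : rel V := [rel x y | E x y || E y x].

Definition connected_on (C : {set V}) : bool :=
  [forall x in C, forall y in C,
     connect [rel a b | [&& a \in C, b \in C & uedge a b]] x y].

(* Underlying undirected graph; one vertex or one edge counts as biconnected. *)
Definition biconnected (C : {set V}) : bool :=
  connected_on C && [forall v in C, connected_on (C :\ v)].

(* Maximal biconnected subgraphs are induced, hence given by vertex sets. *)
Definition biconnected_component (C : {set V}) : bool := maxset biconnected C.

(* [connect E a x]: [a] is an ancestor of [x], possibly [a = x]. *)
Definition common_ancestor (x y a : V) : bool := connect E a x && connect E a y.

(* In a galled-tree exactly one [a] satisfies this for given leaves [x], [y]. *)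
Definition is_lca (x y a : V) : bool :=
  common_ancestor x y a &&
  [forall b, (common_ancestor x y b && connect E a b) ==> (b == a)].

Variable X : {set V}.

Definition single_vertex_network : Prop :=
  exists x : V, [/\ [set: V] = [set x], X = [set x] & forall u v, ~~ E u v].

Definition galled_N1 : Prop :=
  exists r : V, unique is_root r /\ 2 <= outdeg r.

Definition galled_N2 : Prop :=
  forall x : V, x \in X <-> outdeg x = 0 /\ indeg x = 1.

Definition galled_N3 : Prop :=
  forall v : V, ~~ is_root v -> v \notin X ->
    (indeg v = 1 /\ 2 <= outdeg v) \/ (indeg v = 2 /\ 1 <= outdeg v).

Definition galled_N4 : Prop :=
  forall C : {set V}, biconnected_component C ->
    #|[set h in C | hybrid h & [set u | E u h] \subset C]| <= 1.

Definition galled_tree : Prop :=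
  [/\ X != set0, acyclic &
      single_vertex_network \/ [/\ galled_N1, galled_N2, galled_N3 & galled_N4]].

End Digraphs.

Inductive label := L0 | L1 | Lodot.

Definition is_L1 (l : label) : bool := if l is L1 then true else false.

Definition labeled_galled_tree (V : finType) (E : rel V) (X : {set V})
    (t : V -> label) : Prop :=
  galled_tree E X /\ (forall v, t v = Lodot <-> v \in X).

Section Explained.
Variables (V : finType) (E : rel V) (X : {set V}) (t : V -> label).

Definition explained_edge : rel {x : V | x \in X} :=
  [rel x y | (x != y) && [exists a, is_lca E (val x) (val y) a && is_L1 (t a)]].

Lemma explained_edge_sym : symmetric explained_edge.
Proof.
move=> x y; rewrite /explained_edge /= eq_sym; congr andb; apply: eq_existsb => a.
have cC b : common_ancestor E (val x) (val y) b = common_ancestor E (val y) (val x) b.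
  by rewrite /common_ancestor andbC.
congr andb; rewrite /is_lca cC; congr andb.
by apply: eq_forallb => b; rewrite cC.
Qed.

Lemma explained_edge_irr : irreflexive explained_edge.
Proof. by move=> x; rewrite /explained_edge /= eqxx. Qed.

Definition explained_graph : sgraph :=
  SGraph explained_edge_sym explained_edge_irr.

End Explained.

Definition GaTEx (G : sgraph) : Prop :=
  exists (V : finType) (E : rel V) (X : {set V}) (t : V -> label),
    labeled_galled_tree E X t /\ sg_iso G (explained_graph E X t).

Record trigraph := Trigraph {
  tvertex :> finType;
  black : rel tvertex;
  red : rel tvertex;
  black_sym : symmetric black;
  black_irr : irreflexive black;
  red_sym : symmetric red;
  red_irr : irreflexive red;
  black_red_disj : forall x y, ~~ (black x y && red x y)
}.

Definition tedge (G : trigraph) : rel G := [rel x y | black x y || red x y].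

Definition max_red_degree (G : trigraph) : nat :=
  \max_(x : G) #|[set y | red x y]|.

(* Meaningful for [u != v]; the new vertex is [None]. *)
Section Contraction.
Variables (G : trigraph) (u v : G).

Definition contract_vertex : finType :=
  option {x : G | (x != u) && (x != v)}.

Definition new_black (x : G) : bool := black u x && black v x.
Definition new_red (x : G) : bool :=
  (tedge u x || tedge v x) && ~~ new_black x.

Definition contract_black (a b : contract_vertex) : bool :=
  match a, b with
  | Some x, Some y => black (val x) (val y)
  | Some x, None | None, Some x => new_black (val x)
  | None, None => false
  end.

Definition contract_red (a b : contract_vertex) : bool :=
  match a, b with
  | Some x, Some y => red (val x) (val y)
  | Some x, None | None, Some x => new_red (val x)
  | None, None => false
  end.

Lemma contract_black_sym : symmetric contract_black.
Proof. by move=> [x|] [y|] //=; apply: black_sym. Qed.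

Lemma contract_black_irr : irreflexive contract_black.
Proof. by move=> [x|] //=; apply: black_irr. Qed.

Lemma contract_red_sym : symmetric contract_red.
Proof. by move=> [x|] [y|] //=; apply: red_sym. Qed.

Lemma contract_red_irr : irreflexive contract_red.
Proof. by move=> [x|] //=; apply: red_irr. Qed.

Lemma contract_disj a b : ~~ (contract_black a b && contract_red a b).
Proof.
by case: a b => [x|] [y|] //=; rewrite /new_red ?black_red_disj //;
  case: new_black; rewrite ?andbF.
Qed.

Definition contract : trigraph :=
  Trigraph contract_black_sym contract_black_irr
           contract_red_sym contract_red_irr contract_disj.

Lemma card_contract : u != v -> #|contract| = #|G|.-1.
Proof.
move=> uv; rewrite card_option card_sig.
have -> : #|[pred x | (x != u) && (x != v)]| = #|~: [set u; v]|.
  by apply: eq_card => x; rewrite !inE negb_or.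
by rewrite -(cardsC [set u; v]) cards2 uv.
Qed.

End Contraction.

Section TrigraphOfGraph.
Variable G : sgraph.

Definition no_red : rel G := [rel _ _ | false].

Lemma no_red_disj (x y : G) : ~~ (sedge x y && no_red x y).
Proof. by rewrite andbF. Qed.

Definition trigraph_of : trigraph :=
  @Trigraph G (@sedge G) no_red (@sedge_sym G) (@sedge_irr G)
    (fun _ _ => erefl) (fun _ => erefl) no_red_disj.

End TrigraphOfGraph.

(* Some [k] successive contractions starting from [G] keep the maximum red
   degree at most [d] in all [k + 1] trigraphs. *)
Fixpoint contractible_in (k d : nat) (G : trigraph) : bool :=
  (max_red_degree G <= d) &&
  (if k is k'.+1
   then [exists u : G, exists v : G,
           (u != v) && contractible_in k' d (contract u v)]
   else true).

(* [#|G|.-1] contractions lead to a single vertex; a graph with no vertex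
   is [0]-collapsible by convention. *)
Definition collapsible (d : nat) (G : sgraph) : bool :=
  contractible_in #|G|.-1 d (trigraph_of G).

Lemma max_red_degree_le (G : trigraph) : max_red_degree G <= #|G|.
Proof. by apply/bigmax_leqP => x _; apply: max_card. Qed.

Lemma contractible_in_large (k d : nat) (G : trigraph) :
  k = #|G|.-1 -> #|G| <= d -> contractible_in k d G.
Proof.
elim: k G => [|k IH] G kG Gd /=; rewrite (leq_trans (max_red_degree_le G) Gd) //=.
have /card_gt1P [u [v [_ _ uv]]] : 1 < #|G| by case: #|G| kG => [|[|]].
apply/existsP; exists u; apply/existsP; exists v; rewrite uv /=.
apply: IH; rewrite card_contract // -?kG //.
by apply: leq_trans Gd; rewrite kG leq_pred.
Qed.

Lemma collapsible_ex (G : sgraph) : exists d, collapsible d G.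
Proof. by exists #|G|; apply: contractible_in_large. Qed.

Definition tww (G : sgraph) : nat := ex_minn (collapsible_ex G).

(* Main.v *)
Require Import Defs.
From mathcomp Require Import all_boot.
Set Implicit Arguments.
Unset Strict Implicit.
Unset Printing Implicit Defensive.

(** Contracting a module never creates a red edge leaving it, so modules may be
    collapsed one after the other.  Let [S] be a set of leaves and [v] a lowest
    vertex above all of [S].  Either [S] splits into two parts joined completely
    or not at all, or [S] hangs below a single gall with top [v] and hybrid [h].
    In the latter case the leaves having the same ancestors inside the gall form a
    module; picking one leaf per module gives [a_1, .., a_k] and [b_1, .., b_l] on
    the two sides and one leaf [c] below [h], where the adjacency of [a_i] to [c]
    and to [a_j], [j > i], depends only on [i], similarly for the [b_i], and the
    adjacency of [a_i] to [b_j] is constant.  Contract the [a_i] into one vertex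
    from the bottom up, the only red edge being the one to [c]; then contract
    [b_l], .., [b_1] into [c], the only red edge being the one to [a].

    The galls are found through dominators: if [v] is the immediate dominator of a
    hybrid [h], the vertices between [v] and [h] form a biconnected set containing
    the parents of all its vertices but [v], so that (N4) applies to it.

    Twin-width [0] is characterised by twins: two vertices of an induced [P_4] are
    never twins, and a [P_4]-free graph or its complement is disconnected. *)

(** * Contractions of edge-coloured vertex sets *)

Section ColoredSets.
Variable V : finType.
Implicit Types (A B S M R T : {set V}) (w : V -> V -> option bool).

(* Colours of pairs: [Some true] is a black edge, [Some false] a non-edge and
   [None] a red edge. *)
Definition join_color (c c' : option bool) : option bool :=
  if c == c' then c else None.

(* Contraction of [u] and [v], the new vertex being called [u]; [v] is to be
   removed from the vertex set. *)
Definition fuse w (u v : V) : V -> V -> option bool := fun x y =>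
  if x == u then join_color (w u y) (w v y)
  else if y == u then join_color (w x u) (w x v) else w x y.

(** The diagonal is left out because [fuse] produces meaningless values there. *)
Definition red_bounded (d : nat) S w : Prop :=
  forall x, x \in S -> #|[set y in S | (y != x) && (w x y == None)]| <= d.

(** All contractions take place inside one type [V] while the vertex set shrinks; for trigraphs the
    vertex type itself would change at every step. A set with at most one vertex has no red edge, so
    [coll_small] asks for no bound. *)
Inductive coll (d : nat) : {set V} -> (V -> V -> option bool) -> Prop :=
| coll_small S w : #|S| <= 1 -> coll d S w
| coll_step S w u v : u \in S -> v \in S -> u != v -> red_bounded d S w ->
    coll d (S :\ v) (fuse w u v) -> coll d S w.

Lemma join_colorxx c : join_color c c = c.
Proof. by rewrite /join_color eqxx. Qed.

Lemma fuse_sym w u v : (forall x y, w x y = w y x) ->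
  forall x y, fuse w u v x y = fuse w u v y x.
Proof.
move=> ws x y; rewrite /fuse.
case: (x =P u) => [->|_]; case: (y =P u) => [e|_] //; rewrite ?e //.
  by rewrite (ws u) (ws v).
by rewrite (ws x u) (ws x v).
Qed.

Lemma coll_ext d S w w' : coll d S w ->
  (forall x y, x \in S -> y \in S -> x != y -> w x y = w' x y) -> coll d S w'.
Proof.
move=> cS; elim: cS w' => {S w} [S w S1 w' _|S w u v uS vS uv rb _ IH w' ww'].
  exact: coll_small.
apply: (coll_step uS vS uv).
  move=> x xS; rewrite -(eq_card (A := [set y in S | (y != x) && (w x y == None)])).
    exact: rb.
  move=> y; rewrite !inE; case yS: (y \in S) => //=.
  by case: (eqVneq y x) => //= yx; rewrite ww' // eq_sym.
apply: IH => x y; rewrite !inE => /andP[xv xS] /andP[yv yS] xy; rewrite /fuse.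
case: (eqVneq x u) xy => [-> uy|xu xy].
  by rewrite (ww' u) // (ww' v) // eq_sym.
by case: (eqVneq y u) => [_|yu]; rewrite !ww'.
Qed.

(** Fusing two vertices of the module [M] joins equal colours towards [R], so the contractions of
    [M] never touch a pair meeting [R]. Which vertex of [M] survives is not known beforehand; hence
    the last hypothesis ranges over all [m]. *)
Lemma coll_module d M w : coll d M w -> M != set0 -> forall R,
  [disjoint M & R] -> (forall x y, w x y = w y x) ->
  (forall x x' y, x \in M -> x' \in M -> y \in R -> w x y = w x' y) ->
  (forall x y, x \in M -> y \in R -> w x y != None) ->
  (forall x y, x \in R -> y \in R -> x != y -> w x y != None) ->
  (forall m, m \in M -> coll d (m |: R) w) -> coll d (M :|: R) w.
Proof.
elim=> {M w} [M w M1 M0 R _ _ _ _ _ cR|M w u v uM vM uv rb cM IH M0 R dMR ws hM nM nR cR].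
  have /set0Pn[m mM] := M0.
  suff -> : M = [set m] by apply: cR.
  apply/eqP; rewrite eq_sym eqEcard sub1set mM cards1 //.
have nMR x : x \in M -> x \in R = false by move=> xM; apply: (disjointFr dMR).
have nRM x : x \in R -> x \in M = false by move=> xR; apply: (disjointFl dMR).
have vR := nMR _ vM; have uR := nMR _ uM.
apply: (@coll_step _ _ _ u v); rewrite ?inE ?uM ?vM //.
  move=> x; rewrite inE => /orP[xM|xR].
    apply: leq_trans (rb x xM); apply: subset_leq_card; apply/subsetP => y.
    rewrite !inE => /andP[/orP[yM|yR] /andP[yx yN]]; first by rewrite yM yx.
    by rewrite (negPf (nM _ _ xM yR)) in yN.
  rewrite (_ : [set y in _ | _] = set0) ?cards0 //; apply/setP => y.
  rewrite !inE; apply/negbTE/negP => /andP[/orP[yM|yR] /andP[yx yN]].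
    by rewrite ws (negPf (nM _ _ yM xR)) in yN.
  by rewrite (negPf (nR _ _ xR yR _)) // eq_sym in yN.
have -> : (M :|: R) :\ v = (M :\ v) :|: R.
  apply/setP => x; rewrite !inE; case: (eqVneq x v) => //= ->.
  by rewrite vR.
have mg x y : x \in M -> y \in R -> fuse w u v x y = w x y.
  move=> xM yR; rewrite /fuse; case: (eqVneq x u) => [->|xu].
    by rewrite (hM v u y) // join_colorxx.
  by case: (eqVneq y u) => // yu; rewrite yu uR in yR.
have mgR x y : x \in R -> y \in R -> fuse w u v x y = w x y.
  move=> xR yR; rewrite /fuse.
  case: (eqVneq x u) => [xu|_]; first by rewrite xu uR in xR.
  by case: (eqVneq y u) => // yu; rewrite yu uR in yR.
apply: IH => //.
- by apply/set0Pn; exists u; rewrite !inE uv.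
- rewrite disjoint_sym; apply: disjointWr (subsetDl M [set v]) _.
  by rewrite disjoint_sym.
- exact: fuse_sym.
- by move=> x x' y; rewrite !inE => /andP[_ ?] /andP[_ ?] ?; rewrite !mg //; apply: hM.
- by move=> x y; rewrite !inE => /andP[_ ?] ?; rewrite mg //; apply: nM.
- by move=> x y xR yR; rewrite mgR //; apply: nR.
move=> m; rewrite !inE => /andP[_ mM]; apply: (coll_ext (cR m mM)) => x y.
rewrite !inE => /orP[/eqP->|xR] /orP[/eqP->|yR] xy; rewrite ?eqxx // in xy *.
- by rewrite mg.
- by rewrite fuse_sym // mg // ws.
- by rewrite mgR.
Qed.

(** * From coloured vertex sets to trigraphs *)

Definition color (T : trigraph) (x y : T) : option bool :=
  if black x y then Some true else if red x y then None else Some false.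

Lemma color_sym (T : trigraph) (x y : T) : color x y = color y x.
Proof. by rewrite /color black_sym red_sym. Qed.

Lemma red_color (T : trigraph) (x y : T) : red x y = (color x y == None).
Proof.
by rewrite /color; have := black_red_disj x y; case: (black x y); case: (red x y).
Qed.

Lemma max_red_degree_small (T : trigraph) : #|T| <= 1 -> max_red_degree T = 0.
Proof.
move=> T1; apply/eqP; rewrite -leqn0; apply/bigmax_leqP => x _.
rewrite leqn0 cards_eq0; apply/eqP/setP => y.
by rewrite !inE (fintype_le1P T1 y x) red_irr.
Qed.

Lemma color_contract (T : trigraph) (a b x : T) (xP : (x != a) && (x != b)) :
  @color (contract a b) None (Some (Sub x xP)) = join_color (color a x) (color b x).
Proof.
rewrite /color /= /new_red /new_black /tedge /join_color /=.
have := black_red_disj a x; have := black_red_disj b x.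
by case: (black a x); case: (black b x); case: (red a x); case: (red b x).
Qed.

Lemma coll_contractible d S w : coll d S w -> forall (T : trigraph) (f : T -> V),
  injective f -> S = f @: T ->
  (forall x y, x != y -> color x y = w (f x) (f y)) ->
  contractible_in #|S|.-1 d T.
Proof.
elim=> {S w} [S w S1 T f fi eS fc|S w u v uS vS uv rb cS IH T f fi eS fc].
  have cS : #|S| = #|T| by rewrite eS card_imset.
  have -> : #|S|.-1 = 0 by case: #|S| S1 => [|[|]].
  by rewrite /= max_red_degree_small // -cS.
have cT : max_red_degree T <= d.
  apply/bigmax_leqP => x _; have fxS : f x \in S by rewrite eS imset_f.
  apply: leq_trans (rb _ fxS); rewrite -(card_imset _ fi); apply: subset_leq_card.
  apply/subsetP => _ /imsetP[y + ->]; rewrite inE => rxy; rewrite !inE eS imset_f //=.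
  have xy : x != y by apply: contraTneq rxy => ->; rewrite red_irr.
  by rewrite (inj_eq fi) eq_sym xy -fc // -red_color.
have -> : #|S|.-1 = #|S :\ v|.-1.+1.
  rewrite (cardsD1 v S) vS add1n /= prednK //.
  by apply/card_gt0P; exists u; rewrite !inE uv.
move: (uS) (vS); rewrite {1 2}eS => /imsetP[a _ ua] /imsetP[b _ vb].
have ab : a != b by apply: contraNneq uv => e; rewrite ua vb e.
rewrite /= cT /=; apply/existsP; exists a; apply/existsP; exists b; rewrite ab /=.
(* The new vertex [None] inherits the name [u = f a], in agreement with [fuse]. *)
pose g (z : contract a b) := if z is Some x then f (val x) else f a.
have gi : injective g.
  move=> [[x /= xP]|] [[y /= yP]|] //= /fi xy.
  - by congr Some; apply: val_inj.
  - by case/andP: (xP); rewrite {1}xy eqxx.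
  - by case/andP: (yP); rewrite -{1}xy eqxx.
have fu (x : T) : (x != a) && (x != b) -> f x != u.
  by move=> /andP[xa _]; rewrite ua (inj_eq fi).
have cN x (xP : (x != a) && (x != b)) :
    @color (contract a b) None (Some (Sub x xP)) = join_color (w u (f x)) (w v (f x)).
  by have /andP[xa xb] := xP; rewrite color_contract !fc 1?eq_sym // -ua -vb.
apply: (IH _ g gi).
  apply/setP => x; rewrite !inE eS.
  apply/andP/imsetP => [[xv /imsetP[y _ e]]|[[[y yP]|] _ ->] /=].
  - case: (eqVneq y a) => [ya|ya]; first by exists None; rewrite //= e ya.
    have yP : (y != a) && (y != b).
      by rewrite ya /=; apply: contraNneq xv => yb; rewrite e yb vb.
    by exists (Some (Sub y yP)).
  - by rewrite imset_f // vb (inj_eq fi); case/andP: yP => _ ->.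
  - by rewrite -ua uv ua imset_f.
move=> [[x xP]|] [[y yP]|] // xy; rewrite /fuse [g _]/= [g _]/=.
- by rewrite !(negPf (fu _ _)) //= -fc.
- rewrite (negPf (fu _ _)) //= -ua eqxx color_sym cN ua vb.
  have /andP[xa xb] := xP; rewrite -!fc // 1?eq_sym //.
  by rewrite !(color_sym x).
- by rewrite -ua eqxx cN.
Qed.


(** The fibres of [phi] are modules: by [coll_module] each one with at least two elements can be
    shrunk to a single element, until a transversal [T] of the fibres is left. *)
Lemma coll_fibres d (K : eqType) (phi : V -> K) (w : V -> V -> option bool) S :
  (forall x y, w x y = w y x) -> (forall x y, w x y != None) ->
  (forall x x' y, x \in S -> x' \in S -> y \in S -> phi x = phi x' ->
     phi y != phi x -> w x y = w x' y) ->
  (forall x, x \in S -> coll d [set y in S | phi y == phi x] w) ->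
  (forall T, T \subset S -> {in T &, injective phi} ->
     (forall x, x \in S -> exists2 y, y \in T & phi y = phi x) -> coll d T w) ->
  coll d S w.
Proof.
move=> ws wN; have [n] := ubnP #|S|; elim: n S => // n IH S ltS hS fS tS.
have [/forall_inP iS|] :=
  boolP [forall x in S, forall y in S, (phi x == phi y) ==> (x == y)].
  apply: (tS) => // [x y xS yS e|x xS]; last by exists x.
  by have /forall_inP/(_ y yS) := iS x xS; rewrite e eqxx => /eqP.
case/forall_inPn => x xS /forall_inPn[x' x'S]; rewrite negb_imply => /andP[/eqP e nx].
pose M := [set y in S | phi y == phi x].
have xM : x \in M by rewrite !inE xS eqxx.
have x'M : x' \in M by rewrite !inE x'S e eqxx.
have -> : S = M :|: (S :\: M) by rewrite setDE setUIr setUCr setIT;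
  apply/esym/setUidPr/subsetP => y; rewrite inE => /andP[].
apply: coll_module => //.
- exact: fS.
- by apply/set0Pn; exists x.
- by rewrite -setI_eq0; apply/eqP/setP => y; rewrite !inE; case: (y \in S);
    case: (phi y == _).
- move=> y z r; rewrite !inE => /andP[yS /eqP py] /andP[zS /eqP pz] /andP[].
  by move=> + rS; rewrite rS /= => pr; apply: hS => //; rewrite ?py ?pz.
move=> m mM; have mS : m \in S by case/setIdP: mM.
have pm : phi m = phi x by case/setIdP: mM => _ /eqP.
have sub : m |: S :\: M \subset S.
  by apply/subsetP => y; rewrite !inE => /orP[/eqP->|/andP[]].
(* One of the two elements [x], [x'] of the fibre differs from [m] and has disappeared. *)
have lt1 : #|m |: S :\: M| < #|S|.
  apply: proper_card; rewrite properE sub /=; apply/subsetPn.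
  have [xm|xm] := eqVneq x m.
    by exists x' => //; rewrite !inE x'S e eqxx /= ?orbF -xm eq_sym.
  by exists x => //; rewrite !inE xS eqxx /= ?orbF.
apply: IH.
- exact: leq_trans lt1 ltS.
- by move=> a b c aS bS cS; apply: hS; apply: (subsetP sub).
- move=> a aS; have [pa|pa] := eqVneq (phi a) (phi x).
    apply: coll_small; apply/card_le1_eqP => b c;
      rewrite !inE pa => /andP[+ /eqP pb] /andP[+ /eqP pc].
    by rewrite pb pc eqxx !andbT !andNb !orbF => /eqP-> /eqP->.
  rewrite (_ : [set y in _ | _] = [set y in S | phi y == phi a]);
    first exact/fS/(subsetP sub).
  apply/setP => b; rewrite !inE; case: (eqVneq (phi b) (phi a)); rewrite ?andbF // => pb.
  rewrite pb (negPf pa) !andbT /=; case: (eqVneq b m) => [bm|_].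
    by rewrite -pb bm pm eqxx in pa.
  by rewrite andbF.
move=> T TS iT sT; apply: tS => //; first exact: subset_trans TS sub.
move=> y yS; have [py|py] := eqVneq (phi y) (phi x).
  by rewrite py -pm; apply: sT; rewrite !inE eqxx.
by apply: sT; rewrite !inE yS (negPf py) orbT.
Qed.

Lemma coll_pair d S w : #|S| <= 2 -> red_bounded d S w -> coll d S w.
Proof.
move=> S2 rb; have [S1|] := leqP #|S| 1; first exact: coll_small.
case/card_gt1P=> u [v [uS vS uv]]; apply: (coll_step uS vS uv rb).
by apply: coll_small; rewrite (cardsD1 v) vS in S2.
Qed.

Lemma red_bounded_none d S w : (forall x y, w x y != None) -> red_bounded d S w.
Proof.
move=> wN x _; rewrite (_ : [set y in S | _] = set0) ?cards0 //.
by apply/setP => y; rewrite !inE (negPf (wN x y)) !andbF.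
Qed.

(** [A] and [B] are the fibres of membership in [A], and a transversal has at most two elements. *)
Lemma coll_bipartition d A B w k : (forall x y, w x y = w y x) ->
  (forall x y, w x y != None) ->
  (forall x y, x \in A -> y \in B -> w x y = k) ->
  coll d A w -> coll d B w -> [disjoint A & B] -> coll d (A :|: B) w.
Proof.
move=> ws wN hAB cA cB dAB.
have nB x : x \in B -> x \in A = false by apply: (disjointFl dAB).
apply: (coll_fibres (phi := fun x => x \in A)) => //.
- move=> x x' y; rewrite !inE.
  case xA: (x \in A); case x'A: (x' \in A); case yA: (y \in A) => //= xB x'B yB _ _.
    by rewrite !hAB.
  by rewrite ws (ws x') !hAB.
- move=> x _; case xA: (x \in A).
    by rewrite (_ : [set y in _ | _] = A) //; apply/setP => y; rewrite !inE;
      case: (y \in A); rewrite ?andbF.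
  rewrite (_ : [set y in _ | _] = B) //; apply/setP => y; rewrite !inE.
  by case yB: (y \in B); [rewrite nB | case: (y \in A)].
move=> T _ iT _; apply: coll_pair; last exact: red_bounded_none.
rewrite -(card_in_imset iT); apply: leq_trans (max_card _) _.
by rewrite card_bool.
Qed.

End ColoredSets.

(** * Collapsing one representative per module of a gall *)

Section Polar.
Variables (V : finType) (side : V -> bool) (rank : V -> nat) (tau : V -> bool).
Variables (t0 : bool) (c : V).
Implicit Types (S T : {set V}) (w : V -> V -> option bool).

(** A larger [rank] means a lower position in the gall: the rank will be the number of inner
    ancestors. *)
Definition lowest T (x : V) : Prop :=
  [/\ x \in T, x != c & forall y, y \in T -> y != c -> side y = side x ->
      rank y <= rank x].

(* Only the lowest vertex of the side [true] may be joined to [c] by a red edge;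
   this invariant survives both kinds of contractions. *)
Lemma coll_polar T w : c \in T -> (forall x y, w x y = w y x) ->
  (forall x y, x \in T -> y \in T -> x != c -> y != c ->
     side x != side y -> w x y = Some t0) ->
  (forall x y, x \in T -> y \in T -> x != c -> y != c -> x != y ->
     side x = side y -> rank x != rank y) ->
  (forall x y, x \in T -> y \in T -> x != c -> y != c -> side x = side y ->
     rank x < rank y -> w x y = Some (tau x)) ->
  (forall x, x \in T -> x != c -> ~ (side x /\ lowest T x) ->
     w x c = Some (tau x)) ->
  coll 1 T w.
Proof.
have [n] := ubnP #|T|; elim: n T w => // n IH T w ltT cT ws wo rk wl wc.
pose A := [set x in T | (x != c) && side x].
pose B := [set x in T | (x != c) && ~~ side x].
have low (T' : {set V}) (b : bool) x : x \in T' -> x != c -> side x = b ->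
    exists y, lowest T' y /\ side y = b.
  move=> xT xc sx; pose P y := [&& y \in T', y != c & side y == b].
  have xP : P x by rewrite /P xT xc sx eqxx.
  case: (arg_maxnP rank xP) => y /and3P[yT yc /eqP sy] ym; exists y; split=> //.
  by split=> // z zT zc sz; apply: ym; rewrite /P zT zc sz sy eqxx.
have lowU x y : lowest T x -> lowest T y -> side x = side y -> x = y.
  move=> [xT xc xm] [yT yc ym] s; apply/eqP/contraT => xy.
  have := rk x y xT yT xc yc xy s.
  by rewrite eqn_leq xm // ym.
(* All other colours are prescribed by the hypotheses, so there is at most one red edge. *)
have wred x y : x \in T -> y \in T -> x != y -> x != c -> w x y = None ->
    y = c /\ (side x /\ lowest T x).
  move=> xT yT xy xc wN; have [yc|yc] := eqVneq y c.
    split=> //; have [sx|sx] := boolP (side x); last first.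
      by move: wN; rewrite yc wc // => -[e _]; rewrite e in sx.
    have [/forall_inP lx|] :=
      boolP [forall z in T, (z != c) && (side z == side x) ==> (rank z <= rank x)].
      split=> //; split=> // z zT zc sz; have := lx z zT.
      by rewrite zc sz eqxx.
    case/forall_inPn => z zT; rewrite negb_imply => /andP[/andP[zc /eqP sz] rz].
    move: wN; rewrite yc wc // => -[_ [_ _ /(_ z zT zc sz)]].
    by rewrite (negPf rz).
  move: wN; have [s|s] := eqVneq (side x) (side y); last by rewrite wo.
  have := rk x y xT yT xc yc xy s; rewrite neq_ltn => /orP[r|r].
    by rewrite wl.
  by rewrite ws wl.
have rb : red_bounded 1 T w.
  move=> x xT; apply/card_le1_eqP => y z; rewrite !inE.
  move=> /and3P[yT yx /eqP wy] /and3P[zT zx /eqP wz].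
  have [xc|xc] := eqVneq x c.
    rewrite xc ws in wy; rewrite xc ws in wz; rewrite xc in yx zx.
    have [_ [sy ly]] := wred y c yT cT yx yx wy.
    have [_ [sz lz]] := wred z c zT cT zx zx wz.
    by apply: lowU; rewrite ?sy.
  rewrite eq_sym in yx; rewrite eq_sym in zx.
  by have [-> _] := wred _ _ xT yT yx xc wy; have [-> _] := wred _ _ xT zT zx xc wz.
have [|A1] := ltnP 1 #|A|.
  case/card_gt1P => x [x' [xA x'A xx']].
  have [xT xc sx] : [/\ x \in T, x != c & side x] by move: xA; rewrite inE => /and3P[].
  have [x'T x'c sx'] : [/\ x' \in T, x' != c & side x'] by move: x'A;
    rewrite inE => /and3P[].
  have [a [la sa]] := low T true x xT xc sx.
  have [aT ac am] := la.
  have [a' [la' sa']] : exists y, lowest (T :\ a) y /\ side y = true.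
    have [xa|xa] := eqVneq x a; last by apply: low xc sx; rewrite !inE xa.
    by apply: low x'c sx'; rewrite !inE -xa eq_sym xx'.
  have [a'T' a'c am'] := la'; have /setD1P[a'a a'T] := a'T'.
  (* The lowest vertex [a] of the side [true] is merged into the next one, [a']. Vertices higher up
     on this side see both alike, and so does the other side; only the pair with [c] may become red,
     and [a'] is now lowest. *)
  apply: (coll_step a'T aT a'a rb); apply: IH.
  - by move: ltT; rewrite (cardsD1 a) aT.
  - by rewrite !inE eq_sym ac.
  - exact: fuse_sym.
  - move=> y z /setD1P[ya yT] /setD1P[za zT] yc zc s; rewrite /fuse.
    case: (y =P a') => [ya'|_].
      by rewrite !wo ?join_colorxx //; rewrite ?sa -?sa' -?ya'.
    case: (z =P a') => [za'|_]; last by rewrite wo.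
    by rewrite !wo ?join_colorxx //; rewrite ?sa -?sa' -?za'.
  - by move=> y z /setD1P[ya yT] /setD1P[za zT]; apply: rk.
  - move=> y z yT' zT' yc zc s r; have /setD1P[ya yT] := yT'; have /setD1P[za zT] := zT'.
    rewrite /fuse; case: (y =P a') => [ya'|_].
      by have := am' z zT' zc; rewrite -ya' s leqNgt r => /(_ erefl).
    case: (z =P a') => [za'|_]; last by rewrite wl.
    rewrite za' in r s; rewrite !wl ?join_colorxx // ?s ?sa' //.
    by apply: leq_trans r _; apply: am; rewrite ?sa.
  move=> y yT' yc ny; have /setD1P[ya yT] := yT'; rewrite /fuse.
  case: (y =P a') => [ya'|_]; first by case: ny; rewrite ya'.
  rewrite eq_sym (negPf a'c) wc // => -[sy ly].
  by rewrite (lowU y a) ?eqxx ?sa // in ya.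
have [B0|/set0Pn[x]] := eqVneq B set0.
  apply: coll_pair => //; rewrite (cardsD1 c) cT; apply: leq_trans A1.
  apply: subset_leq_card; apply/subsetP => x; rewrite !inE => /andP[xc xT].
  have : x \notin B by rewrite B0 inE.
  by rewrite inE xT xc negbK.
rewrite inE => /and3P[xT xc /negbTE sx].
have [b [lb sb]] := low T false x xT xc sx.
have [bT bc bm] := lb.
(* At most one vertex is left on the side [true]. The lowest vertex [b] of the other side is merged
   into [c]: the vertices above [b] have the same colour to both. *)
apply: (coll_step cT bT _ rb); first by rewrite eq_sym.
apply: IH.
- by move: ltT; rewrite (cardsD1 b) bT.
- by rewrite !inE eq_sym bc.
- exact: fuse_sym.
- move=> y z /setD1P[yb yT] /setD1P[zb zT] yc zc s.
  by rewrite /fuse (negPf yc) (negPf zc) wo.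
- by move=> y z /setD1P[ya yT] /setD1P[za zT]; apply: rk.
- move=> y z /setD1P[yb yT] /setD1P[zb zT] yc zc s r.
  by rewrite /fuse (negPf yc) (negPf zc) wl.
move=> y yT' yc ny; have /setD1P[yb yT] := yT'; rewrite /fuse (negPf yc) eqxx.
(* On the side [true], [y] would be the only remaining vertex, hence the lowest, whose colour to [c]
   is unconstrained. *)
have sy : side y = false.
  apply: contra_notF ny => sy; split=> //; split=> // z /setD1P[zb zT] zc sz.
  suff -> : z = y by [].
  by apply: (card_le1_eqP A1); rewrite inE ?zT ?zc ?yT ?yc ?sz ?sy.
rewrite wc //; last by rewrite sy; case.
rewrite wl ?join_colorxx // ?sy ?sb //.
by rewrite ltn_neqAle rk ?bm ?sy ?sb.
Qed.

End Polar.

(** * Cographs and twin-width 0 *)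

Section Cographs.
Variable V : finType.
Implicit Types (e : rel V) (A B S : {set V}).

Definition P4_free e : Prop := forall a b c d, uniq [:: a; b; c; d] ->
  [/\ e a b, e b c & e c d] -> ~ [/\ ~~ e a c, ~~ e a d & ~~ e b d].

(** With [k = false] the graph induced on [S] is disconnected, with [k = true] its complement is. *)
Definition homogeneous_split e S : Prop := exists A k,
  [/\ A \subset S, A != set0, S :\: A != set0 &
      forall x y, x \in A -> y \in S :\: A -> e x y = k].

(** If [v] has no neighbour in one of the two parts, that part can be split off. Otherwise either
    [v] is adjacent to all of [S], or its non-neighbours [D] are split off: an edge from [D] to a
    neighbour of [v] would stay inside one part and extend through [v] to an induced path ending in
    the other part. *)
Lemma split_insert e S A v : symmetric e -> P4_free e -> v \notin S ->
  A \subset S -> A != set0 -> S :\: A != set0 ->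
  (forall x y, x \in A -> y \in S :\: A -> e x y = false) ->
  homogeneous_split e (v |: S).
Proof.
move=> es free vS /subsetP AS A0 B0 hAB; set B := S :\: A in B0 hAB.
have inB x : x \in B = (x \notin A) && (x \in S) by rewrite inE.
have vA : v \notin A by apply: contra vS => /AS.
have vB : v \notin B by rewrite inB (negPf vS) andbF.
have [/existsP[n /andP[nA vn]]|/existsPn nA] := boolP [exists x, (x \in A) && e v x];
  last first.
  exists A, false; split=> //.
  - by apply/subsetP => x /AS xS; rewrite !inE xS orbT.
  - by apply/set0Pn; exists v; rewrite !inE eqxx vA.
  move=> x y xA; rewrite !inE => /andP[yA /orP[/eqP->|yS]].
    by rewrite es; have := nA x; rewrite xA => /negbTE.
  by apply: hAB; rewrite // inB yA.
have [/existsP[m /andP[mB vm]]|/existsPn nB] := boolP [exists x, (x \in B) && e v x];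
  last first.
  exists (v |: A), false; split=> //.
  - by apply/subsetP => x; rewrite !inE => /orP[->|/AS->] //; rewrite orbT.
  - by apply/set0Pn; exists v; rewrite !inE eqxx.
  - have /set0Pn[b bB] := B0; apply/set0Pn; exists b; move: (bB);
      rewrite inB !inE => /andP[/negPf-> ->].
    by rewrite orbT orbF andbT; apply: contraNneq vB => <-.
  move=> x y; rewrite !inE negb_or => xA /andP[/andP[yv yA]]; rewrite (negPf yv) /= => yS.
  have yB : y \in B by rewrite inB yA.
  case/orP: xA => [/eqP->|xA]; last exact: hAB.
  by have := nB y; rewrite yB => /negbTE.
(* The forbidden path is [b], [a], [v], [p]. *)
have noP4 (P Q : {set V}) p a b : v \notin P -> v \notin Q -> p \notin P ->
    (forall x y, x \in P -> y \in Q -> e x y = false) ->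
    p \in Q -> e v p -> a \in P -> b \in P -> e v a -> ~~ e v b -> e b a = false.
  move=> vP vQ pP hPQ pQ vp aP bP va nvb; apply/negP => ba.
  apply: (free b a v p); last by rewrite (es b v) nvb !hPQ.
    rewrite /= !inE !negb_or !andbT; apply/and3P; split.
    - apply/and3P; split; last 2 first.
      + by apply: contraNneq vP => <-.
      + by apply: contraNneq pP => <-.
      by apply: contraNneq nvb => ->.
    - by apply/andP; split; [apply: contraNneq vP|apply: contraNneq pP] => <-.
    - by apply: contraNneq vQ => ->.
  by rewrite ba es va vp.
pose D := [set x in S | ~~ e v x].
have [D0|D0] := eqVneq D set0.
  exists [set v], true; split=> //.
  - by rewrite sub1set !inE eqxx.
  - by apply/set0Pn; exists v; rewrite inE.
  - apply/set0Pn; exists n; rewrite !inE AS // orbT andbT.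
    by apply: contraNneq vA => <-.
  move=> x y /set1P->; rewrite !inE => /andP[/negPf-> /= yS].
  apply/negP => /negP vy.
  by have : y \in D by [rewrite inE yS]; rewrite D0 inE.
exists D, false; split=> //.
- by apply/subsetP => x; rewrite !inE => /andP[-> _]; rewrite orbT.
- by apply/set0Pn; exists v; rewrite !inE eqxx (negPf vS).
have hBA x y : x \in B -> y \in A -> e x y = false by move=> ? ?; rewrite es hAB.
have cS x : x \in S -> (x \in A) || (x \in B) by rewrite inB => ->; case: (x \in A).
move=> x y; rewrite !inE => /andP[xS nvx] /andP[]; rewrite negb_and negbK => yn.
case/orP=> [/eqP->|yS]; first by rewrite es (negPf nvx).
have vy : e v y by rewrite yS in yn.
case/orP: (cS x xS) => xX; case/orP: (cS y yS) => yX; do ?[exact: hAB | exact: hBA].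
  by apply: (noP4 A B m) => //; move: mB; rewrite inB => /andP[].
by apply: (noP4 B A n) => //; rewrite inB nA.
Qed.

(** The path is self-complementary: an induced path [a], [b], [c], [d] of the complement is the
    induced path [b], [d], [a], [c] of the graph. *)
Lemma P4_free_compl e : symmetric e -> P4_free e ->
  P4_free [rel x y | (x != y) && ~~ e x y].
Proof.
move=> es free a b c d U /= [/andP[ab nab] /andP[bc nbc] /andP[cd ncd]].
move: U; rewrite /= !inE !negb_or !andbT => /and3P[/and3P[_ ac ad] /andP[_ bd] _].
rewrite ac ad bd /= !negbK => -[eac ead ebd]; apply: (free b d a c).
- by rewrite /= !inE !negb_or bd bc ac (eq_sym d a) (eq_sym d c) ad cd (eq_sym b a) ab.
- by rewrite es in ead; rewrite ebd ead eac.
- by rewrite es in nab; rewrite es in ncd; rewrite nab nbc ncd.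
Qed.

Lemma P4_free_split e S : symmetric e -> P4_free e -> 1 < #|S| ->
  homogeneous_split e S.
Proof.
move=> es free; have [n] := ubnP #|S|; elim: n S => // n IH S ltS S2.
have /card_gt0P[v vS] : 0 < #|S| by apply: ltnW.
have [S1|S1] := leqP #|S :\ v| 1.
  have /card_gt1P[x [y [xS yS xy]]] := S2.
  have eS : S = [set x; y].
    apply/eqP; rewrite eq_sym eqEcard subUset !sub1set xS yS cards2 xy.
    by rewrite (cardsD1 v) vS.
  exists [set x], (e x y); split.
  - by rewrite sub1set.
  - by apply/set0Pn; exists x; rewrite inE.
  - by apply/set0Pn; exists y; rewrite !inE yS eq_sym xy.
  by move=> a b /set1P->; rewrite eS !inE => /andP[/negPf-> /= /eqP->].
have [|A [k [AS A0 B0 hA]]] := IH (S :\ v) _ S1.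
  by move: ltS; rewrite (cardsD1 v) vS.
have vS' : v \notin S :\ v by rewrite !inE eqxx.
(* For [k = true] the vertex [v] is inserted in the complement, and the constant obtained there is
   negated. *)
rewrite -(setD1K vS); case: k hA => hA; last exact: split_insert hA.
have [|x y xA yB|B [k [BS B0' C0 hB]]] :=
  split_insert _ (P4_free_compl es free) vS' AS A0 B0.
- by move=> x y /=; rewrite eq_sym es.
- by rewrite /= hA ?andbF.
exists B, (~~ k); split=> // x y xB yC; rewrite -(hB x y xB yC) /= negb_and !negbK.
by case: eqP => // xy; move: yC; rewrite inE -xy xB.
Qed.

(** Both parts of a split are proper subsets, so this serves as induction step for cographs and for
    galled-trees alike. *)
Lemma coll_split d e S : symmetric e -> homogeneous_split e S ->
  (forall A, A \proper S -> coll d A (fun x y => Some (e x y))) ->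
  coll d S (fun x y => Some (e x y)).
Proof.
move=> es [A [k [AS A0 B0 hA]]] cS.
have -> : S = A :|: (S :\: A) by rewrite -{1}(setID S A) (setIidPr AS).
apply: (coll_bipartition (k := Some k)) => //.
- by move=> x y; rewrite es.
- by move=> x y xA yB; rewrite hA.
- apply: cS; rewrite properE AS; apply: contra B0 => SA.
  by rewrite setD_eq0.
- apply: cS; rewrite properE subsetDl; apply: contra A0 => /subsetP SA.
  by apply/eqP/setP => x; rewrite inE; apply/negP => xA; have :=
    SA x (subsetP AS x xA); rewrite inE xA.
- by rewrite -setI_eq0 setIDA setDIl setDv set0I.
Qed.

Lemma coll_P4_free e S : symmetric e -> P4_free e ->
  coll 0 S (fun x y => Some (e x y)).
Proof.
move=> es free; have [n] := ubnP #|S|; elim: n S => // n IH S ltS.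
have [S1|S2] := leqP #|S| 1; first exact: coll_small.
apply: coll_split => //; first exact: P4_free_split.
by move=> A /proper_card AS; apply: IH; apply: leq_trans AS _.
Qed.

End Cographs.

(** * Collapsibility of graphs and induced paths on four vertices *)

Lemma coll_collapsible d (V : finType) (e : rel V) (G : sgraph) (f : G -> V) :
  injective f -> (forall x y, sedge x y = e (f x) (f y)) ->
  coll d (f @: G) (fun x y => Some (e x y)) -> collapsible d G.
Proof.
move=> fi fe cG; rewrite /collapsible -(card_imset _ fi).
apply: (coll_contractible cG (T := trigraph_of G) fi) => // x y _.
by rewrite /color /= fe; case: (e _ _).
Qed.

Lemma cograph_collapsible G : cograph G -> collapsible 0 G.
Proof.
move=> cG; apply: (@coll_collapsible _ _ (@sedge G) G id) => //.
apply: coll_P4_free; first exact: sedge_sym.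
move=> a b c d U [ab bc cd] [/negPf ac /negPf ad /negPf bd]; apply: cG.
exists (fun i : 'I_4 => nth a [:: a; b; c; d] i).
  move=> i j /eqP; rewrite nth_uniq //= => /eqP; apply: val_inj.
have S := @sedge_sym G.
have I := @sedge_irr G.
case=> [[|[|[|[|i]]]] //= Hi] [[|[|[|[|j]]]] //= Hj];
  rewrite ?I ?ab ?bc ?cd ?ac ?ad ?bd //.
all: by rewrite S ?ab ?bc ?cd ?ac ?ad ?bd.
Qed.

(** Without red edges the contracted vertices are twins, so at most one of them is on the path, and
    the path survives in the contraction down to a single vertex. *)
Lemma collapsible0_no_P4 k (T : trigraph) (f : 'I_4 -> T) : k = #|T|.-1 ->
  contractible_in k 0 T -> injective f ->
  ~ (forall i j : 'I_4, black (f i) (f j) = (i.+1 == j) || (j.+1 == i)).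
Proof.
elim: k T f => [|k IH] T f kT cT fi fb.
  have := leq_card f fi; rewrite card_ord.
  by case: #|T| kT => [|[|]].
move: cT => /= /andP[r0 /existsP[u /existsP[v /andP[uv cT]]]].
have rc : max_red_degree (contract u v) <= 0 by case: (k) cT => [|?] /= /andP[].
have nred (U : trigraph) (x y : U) : max_red_degree U <= 0 -> red x y = false.
  move=> /bigmax_leqP/(_ x isT); rewrite leqn0 cards_eq0 => /eqP/setP/(_ y).
  by rewrite !inE.
have tw x : x != u -> x != v -> black u x = black v x.
  move=> xu xv; have xP : (x != u) && (x != v) by rewrite xu.
  have := nred (contract u v) None (Some (Sub x xP)) rc.
  rewrite /= /new_red /new_black /tedge /= !(nred _ _ _ r0) !orbF.
  by case: (black u x); case: (black v x).
(* Any two vertices of the path are told apart by a third one, adjacent to exactly one of them;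
   twins are not. *)
have nuv i j : f i = u -> f j = v -> False.
  move=> iu jv; have ij : i != j by apply: contraNneq uv => e; rewrite -iu -jv e.
  have [l [li lj]] : exists l : 'I_4, [/\ l != i, l != j &
      ((i.+1 == l) || (l.+1 == i)) != ((j.+1 == l) || (l.+1 == j))].
    case: i j ij {iu jv} => [[|[|[|[|i]]]] //= Hi] [[|[|[|[|j]]]] //= Hj] _;
    by [exists (@Ordinal 4 0 isT)|exists (@Ordinal 4 1 isT)|
      exists (@Ordinal 4 2 isT)|exists (@Ordinal 4 3 isT)].
  by rewrite -!fb iu jv tw ?eqxx // -?iu -?jv (inj_eq fi).
(* The quotient map of the contraction, sending [u] and [v] to [None]. *)
pose g x : contract u v := if insub x is Some y then Some y else None.
have gS x (xP : (x != u) && (x != v)) : g x = Some (Sub x xP).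
  by rewrite /g insubT.
have gN x : ~~ ((x != u) && (x != v)) -> g x = None.
  by move=> xP; rewrite /g insubF //; apply/negbTE.
have gi : injective (g \o f).
  move=> i j /=; have [iP|iP] := boolP ((f i != u) && (f i != v));
  have [jP|jP] := boolP ((f j != u) && (f j != v)); rewrite ?(gS _ iP) ?(gS _ jP) ?gN //.
    by move=> [/fi].
  move=> _; move: iP jP; rewrite !negb_and !negbK => /orP[]/eqP iu /orP[]/eqP ju.
  - by apply: fi; rewrite iu ju.
  - by case: (nuv _ _ iu ju).
  - by case: (nuv _ _ ju iu).
  - by apply: fi; rewrite iu ju.
apply: (IH (contract u v) (g \o f)) => //; first by rewrite card_contract // -kT.
move=> i j; rewrite -fb /=.
have bN x y : ~~ ((x != u) && (x != v)) -> (y != u) && (y != v) ->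
  new_black u v y = black x y.
  rewrite negb_and !negbK /new_black => /orP[]/eqP-> /andP[yu yv]; rewrite tw //.
    by rewrite andbb.
  by rewrite andbb.
have [iP|iP] := boolP ((f i != u) && (f i != v));
have [jP|jP] := boolP ((f j != u) && (f j != v)).
- by rewrite (gS _ iP) (gS _ jP).
- by rewrite (gS _ iP) (gN _ jP) /= black_sym (bN _ _ jP iP).
- by rewrite (gN _ iP) (gS _ jP) /= (bN _ _ iP jP).
rewrite !gN //=; suff -> : i = j by rewrite black_irr.
by apply: gi; rewrite /= !gN.
Qed.

Lemma collapsible0_cograph G : collapsible 0 G -> cograph G.
Proof.
move=> cG [f fi fe]; exact: (@collapsible0_no_P4 _ (trigraph_of G) f erefl cG fi fe).
Qed.

Lemma tww_le d G : collapsible d G -> tww G <= d.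
Proof. by rewrite /tww; case: ex_minnP => m _ h /h. Qed.

Lemma tww0_cograph G : tww G = 0 <-> cograph G.
Proof.
split=> [|/cograph_collapsible/tww_le]; last by rewrite leqn0 => /eqP.
by rewrite /tww; case: ex_minnP => m + _ => /[swap] -> /collapsible0_cograph.
Qed.

(** * Galls and dominators *)

Section Connect.
Variable T : finType.
Implicit Types (e f : rel T) (a b : T).

(** A path from [a] to [b] only uses edges that start below [a] and end above [b]; this transfers
    paths to subrelations such as [avoid] and [urel]. *)
Lemma connect_between e f a b : connect e a b ->
  (forall y z, connect e a y -> e y z -> connect e z b -> f y z) -> connect f a b.
Proof.
case/connectP=> p; elim: p a => [|c p IH] a /=; first by move=> _ ->.
case/andP=> ac pc eb h.
have cb : connect e c b by apply/connectP; exists p.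
apply: connect_trans (connect1 (h a c (connect0 _ _) ac cb)) _.
by apply: IH => // y z cy; apply: h; apply: connect_trans (connect1 ac) cy.
Qed.

Lemma connect_forward e a (P : T -> Prop) : P a ->
  (forall y z, connect e a y -> P y -> e y z -> P z) ->
  forall b, connect e a b -> P b.
Proof.
move=> Pa Pe b /connectP[p]; elim/last_ind: p b => [|p c IH] b /=; first by move=> _ ->.
rewrite rcons_path last_rcons => /andP[ap lc] ->; apply: Pe lc; last exact: IH.
by apply/connectP; exists p.
Qed.

Lemma connect_last e a b : connect e a b -> a != b -> exists2 c, connect e a c & e c b.
Proof.
case/connectP=> p; elim/last_ind: p b => [|p c _] b /=; first by move=> _ ->;
  rewrite eqxx.
rewrite rcons_path last_rcons => /andP[ap lc] -> _; exists (last a p) => //.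
by apply/connectP; exists p.
Qed.

Lemma connect_first e a b : connect e a b -> a != b -> exists2 c, e a c & connect e c b.
Proof.
case/connectP=> [[|c p]] /=; first by move=> _ ->; rewrite eqxx.
by case/andP=> ac pc -> _; exists c => //; apply/connectP; exists p.
Qed.

End Connect.

(** * Unions of biconnected sets and condition (N4) *)

Section Biconnected.
Variables (V : finType) (E : rel V).
Implicit Types (A B C : {set V}).

Definition urel C : rel V := [rel a b | [&& a \in C, b \in C & uedge E a b]].

Lemma urel_sym C : connect_sym (urel C).
Proof.
apply: sym_connect_sym => a b; rewrite /urel /uedge /=.
by case: (a \in C); case: (b \in C) => //=; rewrite orbC.
Qed.

Lemma connected_onP C :
  reflect (forall x y, x \in C -> y \in C -> connect (urel C) x y) (connected_on E C).
Proof.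
apply: (iffP forall_inP) => [h x y xC yC|h x xC].
  by have /forall_inP/(_ y yC) := h x xC.
by apply/forall_inP => y yC; apply: h.
Qed.

Lemma connected_on_hub C c : (forall x, x \in C -> connect (urel C) x c) ->
  connected_on E C.
Proof.
move=> h; apply/connected_onP => x y xC yC; apply: connect_trans (h x xC) _.
by rewrite urel_sym; apply: h.
Qed.

Lemma connected_onU A B p : p \in A -> p \in B ->
  connected_on E A -> connected_on E B -> connected_on E (A :|: B).
Proof.
move=> pA pB /connected_onP cA /connected_onP cB; apply: (@connected_on_hub _ p) => x.
have sub C : C \subset A :|: B -> connect (urel C) x p -> connect (urel (A :|: B)) x p.
  move=> /subsetP CAB; apply: connect_sub => a b /and3P[aC bC ab]; apply: connect1.
  by apply/and3P; rewrite !CAB.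
rewrite inE => /orP[xA|xB].
  by apply: sub (cA _ _ xA pA); apply: subsetUl.
by apply: sub (cB _ _ xB pB); apply: subsetUr.
Qed.

(** After the deletion of any vertex the two sets still share [p] or [q]. *)
Lemma biconnectedU A B p q : p \in A -> p \in B -> q \in A -> q \in B -> p != q ->
  biconnected E A -> biconnected E B -> biconnected E (A :|: B).
Proof.
move=> pA pB qA qB pq /andP[cA /forall_inP dA] /andP[cB /forall_inP dB].
rewrite /biconnected (connected_onU pA) //=; apply/forall_inP => z _.
have cD C : connected_on E C -> (forall x, x \in C -> connected_on E (C :\ x)) ->
    connected_on E (C :\ z).
  move=> cC dC; have [/dC //|zC] := boolP (z \in C).
  by rewrite (setDidPl _) // disjoint_sym disjoints1.
have -> : (A :|: B) :\ z = (A :\ z) :|: (B :\ z) by rewrite setDUl.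
have [pz|pz] := eqVneq p z.
  by apply: (@connected_onU _ _ q); rewrite ?inE -?pz 1?eq_sym ?pq ?qA ?qB // pz cD.
by apply: (@connected_onU _ _ p); rewrite ?inE ?pz ?pA ?pB // cD.
Qed.

(** Extending [C] to a maximal biconnected set makes (N4) available without knowing the component
    itself. *)
Lemma galled_N4_biconnected C h h' : galled_N4 E -> biconnected E C ->
  hybrid E h -> hybrid E h' -> h \in C -> h' \in C ->
  (forall p, E p h -> p \in C) -> (forall p, E p h' -> p \in C) -> h = h'.
Proof.
move=> N4 bC hh hh' hC h'C ph ph'.
have [D mD /subsetP CD] := maxset_exists bC.
apply: (card_le1_eqP (N4 D mD)); rewrite !inE ?hh ?hh' CD //=.
- by apply/subsetP => p; rewrite inE => /ph'; apply: CD.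
- by apply/subsetP => p; rewrite inE => /ph; apply: CD.
Qed.

End Biconnected.

(** * Acyclicity, the root and dominators *)

Section Network.
Variables (V : finType) (E : rel V) (X : {set V}) (r : V).
Hypothesis Eac : acyclic E.
Hypothesis rU : unique (is_root E) r.
Hypothesis EN2 : galled_N2 E X.
Hypothesis EN3 : galled_N3 E X.
Hypothesis EN4 : galled_N4 E.

Local Notation "a ~> b" := (connect E a b) (at level 70).

Lemma edge_connect_absurd a b : E a b -> b ~> a -> False.
Proof.
move=> ab /connectP[p bp e]; suff /Eac : cycle E (b :: p) by [].
by rewrite /= rcons_path bp -e ab.
Qed.

Lemma connect_anti a b : a ~> b -> b ~> a -> a = b.
Proof.
move=> ab ba; apply/eqP/contraT => /(connect_first ab)[c ac cb].
by case: (edge_connect_absurd ac (connect_trans cb ba)).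
Qed.

(** A measure that strictly decreases downwards: its minima are lowest and its maxima highest
    vertices with a given property. *)
Definition ndesc a := #|[set b | a ~> b]|.

Lemma ndesc_lt a b : a ~> b -> a != b -> ndesc b < ndesc a.
Proof.
move=> ab nab; apply: proper_card; rewrite properE; apply/andP; split.
  by apply/subsetP => c; rewrite !inE; apply: connect_trans.
apply/subsetPn; exists a; rewrite !inE ?connect0 //.
by apply: contraNN nab => ba; rewrite (connect_anti ab ba).
Qed.

Lemma root_connect x : r ~> x.
Proof.
have [n] := ubnP #|[set y | y ~> x]|; elim: n x => // n IH x ltx.
have [rx|] := boolP (is_root E x); first by rewrite (rU.2 x rx) connect0.
rewrite /is_root cards_eq0 => /set0Pn[p]; rewrite inE => px.
apply: connect_trans (IH p _) (connect1 px); apply: leq_trans _ (ltx : _ <= n).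
apply: proper_card; rewrite properE; apply/andP; split.
  by apply/subsetP => y; rewrite !inE => yp; apply: connect_trans yp (connect1 px).
apply/subsetPn; exists x; rewrite !inE ?connect0 //.
by apply/negP => /(edge_connect_absurd px).
Qed.

Definition avoid z : rel V := [rel x y | [&& E x y, x != z & y != z]].

(** The dominator relation of flow graphs, except that the root, being reached by the empty path, is
    dominated by nothing. *)
Definition dominates z h : bool := ~~ connect (avoid z) r h.

Lemma connect_avoid_above z a b : a ~> b -> ~~ (z ~> b) -> connect (avoid z) a b.
Proof.
move=> ab nzb; apply: (connect_between ab) => x y ax xy yb; rewrite /avoid /= xy /=.
apply/andP; split; apply: contraNneq nzb => <- //.
exact: connect_trans (connect1 xy) yb.
Qed.

Lemma connect_avoid_below z a b : a ~> b -> ~~ (a ~> z) -> connect (avoid z) a b.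
Proof.
move=> ab nzb; apply: (connect_between ab) => x y ax xy yb; rewrite /avoid /= xy /=.
apply/andP; split; apply: contraNneq nzb => <- //.
exact: connect_trans ax (connect1 xy).
Qed.

Definition inner v h z : bool := [&& v ~> z, z ~> h, z != v & z != h].

(* [v] is the immediate dominator of [h]; the cycle closed by [h] is then the
   interval of vertices between [v] and [h]. *)
Definition gall v h : Prop := [/\ hybrid E h, v != h, dominates v h &
  forall z, inner v h z -> ~~ dominates z h].

Definition interval v h := [set y | (v ~> y) && (y ~> h)].

Lemma dominates_connect v h : dominates v h -> v ~> h.
Proof.
by apply: contraR => nvh; apply: connect_avoid_above (root_connect h) nvh.
Qed.

(** Otherwise a path from the root through [y] to [h] would avoid [v]. *)
Lemma dominates_comparable v h y : dominates v h -> y ~> h -> (v ~> y) || (y ~> v).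
Proof.
move=> dv yh; apply: contraR dv; rewrite negb_or => /andP[nvy nyv].
apply: connect_trans (connect_avoid_above (root_connect y) nvy) _.
exact: connect_avoid_below.
Qed.

Lemma dominates_parent v h y p : dominates v h -> v ~> y -> y != v -> y ~> h ->
  E p y -> v ~> p.
Proof.
move=> dv vy yv yh py; apply: contraR dv => nvp.
apply: connect_trans (connect_avoid_above (root_connect p) nvp) _.
have pv : p != v by apply: contraNneq nvp => ->.
apply: (connect_trans (y := y)); first by apply: connect1; rewrite /avoid /= py pv yv.
by apply: connect_avoid_below yh _; apply: contraNN yv => /(connect_anti vy) ->.
Qed.

(** The root dominates [h]; a lowest dominator other than [h] is the required [v]. *)
Lemma gall_exists h : hybrid E h -> exists v, gall v h.
Proof.
move=> hh; have hr : r != h.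
  by apply: contraTneq hh => <-; rewrite /hybrid; have /eqP-> := rU.1.
pose P v := (v != h) && dominates v h.
have Pr : P r.
  rewrite /P hr /=; apply/negP => /connect_first/(_ hr)[c].
  by rewrite /avoid /= eqxx andbF.
case: (arg_minnP ndesc Pr) => v /andP[vh dv] vm; exists v; split=> //.
move=> z /and4P[vz zh zv nzh]; apply/negP => dz.
have := vm z; rewrite /P nzh dz => /(_ isT); rewrite leqNgt.
by rewrite ndesc_lt // eq_sym.
Qed.

Lemma gall_connect v h : gall v h -> v ~> h.
Proof. by case=> _ _ /dominates_connect. Qed.

(** As [z] does not dominate [h], some path from the root avoids [z]; it must pass through [v], and
    its part after [v] is the path sought. *)
Lemma gall_inner_avoid v h z : gall v h -> inner v h z -> connect (avoid z) v h.
Proof.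
move=> [hh vh dv nd] zi; have := nd z zi; rewrite negbK => rh.
have : connect (avoid v) r h \/ connect (avoid z) v h.
  apply: (connect_forward (P :=
    fun y => connect (avoid v) r y \/ connect (avoid z) v y) _ _ rh).
    by left; apply: connect0.
  move=> x y _ [rx|vx] xy; last by right; apply: connect_trans vx (connect1 xy).
  have [xv|xv] := eqVneq x v; first by right; rewrite -xv; apply: connect1.
  have [->|yv] := eqVneq y v; first by right; apply: connect0.
  left; apply: connect_trans rx (connect1 _); rewrite /avoid /= xv yv.
  by case/and3P: xy => ->.
by case=> // rv; rewrite /dominates rv in dv.
Qed.

(** After the deletion of an inner vertex [z], a vertex not above [z] still descends to [h]. A
    vertex above [z] is still joined to [v], from where a path avoiding [z] leads to [h]. *)
Lemma interval_biconnected v h : gall v h -> biconnected E (interval v h).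
Proof.
move=> g; have vh := gall_connect g; have [_ nvh dv nd] := g.
have sub (C : {set V}) a b (e : rel V) : connect e a b -> subrel e E ->
    (forall y, connect e a y -> connect e y b -> y \in C) -> connect (urel E C) a b.
  move=> ab eE h1; apply: (connect_between ab) => x y ax xy yb;
    rewrite /urel /uedge /= eE //= andbT.
  apply/andP; split; apply: h1 => //.
    exact: connect_trans (connect1 xy) yb.
  exact: connect_trans ax (connect1 xy).
have avE z : subrel (avoid z) E by move=> x y /and3P[].
have avC z a b : connect (avoid z) a b -> a ~> b.
  by apply: connect_sub => x y /avE; apply: connect1.
have avz z a y : a != z -> connect (avoid z) a y -> y != z.
  move=> az ay; have [->//|ny] := eqVneq y a.
  by have [|c _ /and3P[]//] := connect_last ay; rewrite eq_sym.
have sub' z a b : connect (avoid z) a b -> a != z -> v ~> a -> b ~> h ->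
    connect (urel E (interval v h :\ z)) a b.
  move=> ab az va bh; apply: (sub _ _ _ _ ab (avE z)) => y ay yb.
  rewrite !inE (avz _ _ _ az ay) (connect_trans va (avC _ _ _ ay)).
  exact: connect_trans (avC _ _ _ yb) bh.
apply/andP; split.
  apply: (@connected_on_hub _ _ _ h) => x; rewrite inE => /andP[vx xh].
  apply: (sub _ _ _ _ xh) => // y xy yh; rewrite inE yh andbT.
  exact: connect_trans vx xy.
apply/forall_inP => z; rewrite inE => /andP[vz zh].
have up x : x \in interval v h :\ z -> z != v -> ~~ (z ~> x) ->
    connect (urel E (interval v h :\ z)) x v.
  rewrite !inE => /and3P[xz vx xh] zv nzx; rewrite urel_sym; apply: sub' => //.
    exact: connect_avoid_above.
  by rewrite eq_sym.
have dn x : x \in interval v h :\ z -> ~~ (x ~> z) ->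
    connect (urel E (interval v h :\ z)) x h.
  rewrite !inE => /and3P[xz vx xh] nxz; apply: sub' => //.
  exact: connect_avoid_below.
have xz_anti x : x \in interval v h :\ z -> x ~> z -> ~~ (z ~> x).
  by rewrite !inE => /andP[xz _] h1; apply: contraNN xz => h2;
    rewrite (connect_anti h1 h2).
have [ez|zv] := eqVneq z v.
  apply: (@connected_on_hub _ _ _ h) => x xi; apply: dn => //.
  apply: contraTN vz => /(xz_anti x xi); rewrite ez; case/setD1P: xi => _.
  by rewrite inE => /andP[->].
have [ez|nzh] := eqVneq z h.
  apply: (@connected_on_hub _ _ _ v) => x xi; apply: up => //.
  apply: xz_anti => //; rewrite ez; case/setD1P: xi => _.
  by rewrite inE => /andP[].
have zi : inner v h z by rewrite /inner vz zh zv nzh.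
apply: (@connected_on_hub _ _ _ h) => x xi.
have [xz|nxz] := boolP (x ~> z); last exact: dn.
apply: connect_trans (up x xi zv (xz_anti x xi xz)) _.
by apply: sub' => //; [exact: gall_inner_avoid|rewrite eq_sym].
Qed.

Lemma interval_parent v h y p : gall v h -> v ~> y -> y != v -> y ~> h -> E p y ->
  p \in interval v h.
Proof.
move=> [_ _ dv _] vy yv yh py; rewrite inE (dominates_parent dv vy yv yh py).
exact: connect_trans (connect1 py) yh.
Qed.

Lemma two_parents_hybrid h p p' : E p h -> E p' h -> p != p' -> hybrid E h.
Proof.
move=> ph p'h pp'.
have h2 : 1 < indeg E h by apply/card_gt1P; exists p, p'; rewrite !inE ph p'h.
have hr : ~~ is_root E h by rewrite /is_root; case: indeg h2.
have hX : h \notin X.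
  by apply/negP => /EN2[_ e]; rewrite e in h2.
have [[e _]|[e o]] := EN3 hr hX; first by rewrite e in h2.
by rewrite /hybrid e o.
Qed.

Lemma gall_hybrid_in v h : gall v h -> h \in interval v h.
Proof. by move=> g; rewrite inE connect0 gall_connect. Qed.

Lemma gall_parent v h p : gall v h -> E p h -> p \in interval v h.
Proof.
move=> g; have [_ vh _ _] := g.
by apply: (interval_parent g (gall_connect g)); rewrite ?connect0 // eq_sym.
Qed.

(** With two parents, [y] would be a second hybrid of the biconnected interval having all its
    parents there. *)
Lemma inner_one_parent v h y p p' : gall v h -> inner v h y -> E p y -> E p' y -> p = p'.
Proof.
move=> g /and4P[vy yh yv nyh] py p'y; apply/eqP/contraT => pp'.
suff e : y = h by rewrite e eqxx in nyh.
apply: (galled_N4_biconnected EN4 (interval_biconnected g)).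
- exact: two_parents_hybrid py p'y pp'.
- by case: g.
- by rewrite inE vy yh.
- exact: gall_hybrid_in.
- by move=> q; apply: interval_parent.
- by move=> q; apply: gall_parent.
Qed.

(** The two intervals share [z] and a parent of [z], so their union is biconnected and (N4)
    identifies the hybrids. *)
Lemma inner_unique v h v' h' z : gall v h -> gall v' h' -> inner v h z -> inner v' h' z ->
  h = h'.
Proof.
move=> g g' /and4P[vz zh zv _] /and4P[v'z zh' zv' _].
have [|p vp pz] := connect_last vz; first by rewrite eq_sym.
have pi := interval_parent g vz zv zh pz.
have pi' := interval_parent g' v'z zv' zh' pz.
have npz : p != z by apply/eqP => e; rewrite e in pz;
  apply: (edge_connect_absurd pz (connect0 _ _)).
apply: (galled_N4_biconnected EN4 (C := interval v h :|: interval v' h')).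
- apply: (@biconnectedU _ _ _ _ p z); rewrite // ?interval_biconnected //.
    by rewrite inE vz.
  by rewrite inE v'z.
- by case: g.
- by case: g'.
- by rewrite inE gall_hybrid_in.
- by rewrite inE orbC gall_hybrid_in.
- by move=> q /(gall_parent g); rewrite in_setU => ->.
- by move=> q /(gall_parent g'); rewrite in_setU orbC => ->.
Qed.

Lemma gall_unique v v' h : gall v h -> gall v' h -> v = v'.
Proof.
move=> g g'; have [_ vh dv nd] := g; have [_ v'h dv' nd'] := g'.
apply/eqP/contraT => vv'.
case/orP: (dominates_comparable dv (gall_connect g')) => c.
  have := nd v'; rewrite /inner c gall_connect // v'h eq_sym vv' /= => /(_ isT).
  by rewrite dv'.
have := nd' v; rewrite /inner c gall_connect // vh vv' /= => /(_ isT).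
by rewrite dv.
Qed.

(** A highest common descendant [h] of [a] and [b] above [y] is entered from two different parents,
    hence is a hybrid. Its dominator is comparable with [a] and [b], and lies above both because [h]
    is highest and [a], [b] are incomparable. *)
Lemma incomparable_gall a b y : a ~> y -> b ~> y -> ~~ (a ~> b) -> ~~ (b ~> a) ->
  exists v h, [/\ gall v h, inner v h a, inner v h b & h ~> y].
Proof.
move=> ay by_ nab nba.
pose P x := [&& a ~> x, b ~> x & x ~> y].
have Py : P y by rewrite /P ay by_ connect0.
case: (arg_maxnP ndesc Py) => h /and3P[ah bh hy] hm.
have nah : a != h by apply: contraNneq nba => ->.
have nbh : b != h by apply: contraNneq nab => ->.
have hm' x : a ~> x -> b ~> x -> x ~> h -> x = h.
  move=> ax bx xh; apply/eqP/contraT => nxh.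
  have := hm x; rewrite /P ax bx (connect_trans xh hy) => /(_ isT).
  by rewrite /geq /= leqNgt ndesc_lt.
have [p ap ph] := connect_last ah nah.
have [q bq qh] := connect_last bh nbh.
have pq : p != q.
  apply: contraTneq ph => e; apply/negP => ph.
  have bp : b ~> p by rewrite e.
  apply: (edge_connect_absurd ph); rewrite {1}(hm' p ap bp) ?connect0 //.
  exact: connect1.
have [v g] := gall_exists (two_parents_hybrid ph qh pq).
have [_ vh dv _] := g; have hv := gall_connect g.
have nabv : a ~> v -> b ~> v -> False.
  by move=> av bv; rewrite (hm' v av bv hv) eqxx in vh.
have [va vb] : v ~> a /\ v ~> b.
  case/orP: (dominates_comparable dv ah) => [va|av];
  case/orP: (dominates_comparable dv bh) => [vb|bv] //.
  - by rewrite (connect_trans bv va) in nba.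
  - by rewrite (connect_trans av vb) in nab.
  - by case: nabv.
exists v, h; split=> //; rewrite /inner ?ah ?bh ?va ?vb ?nah ?nbh /= andbT.
  by apply: contraNneq nab => ->.
by apply: contraNneq nba => ->.
Qed.

(** Two different candidates are incomparable, so they are inner vertices of a gall whose hybrid is
    above [x] and of one whose hybrid is above [y]. The hybrids coincide by [inner_unique], which
    yields a common ancestor strictly below [a]. *)
Lemma is_lca_unique x y a b : is_lca E x y a -> is_lca E x y b -> a = b.
Proof.
move=> /andP[/andP[ax ay] /forallP am] /andP[/andP[bx by_] /forallP bm].
apply/eqP/contraT => ab.
have nab : ~~ (a ~> b).
  apply/negP => cab; have := am b; rewrite /common_ancestor bx by_ cab /=.
  by rewrite eq_sym (negPf ab).
have nba : ~~ (b ~> a).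
  apply/negP => cab; have := bm a; rewrite /common_ancestor ax ay cab /=.
  by rewrite (negPf ab).
have [v [h [g ia ib hx]]] := incomparable_gall ax bx nab nba.
have [v' [h' [g' ia' ib' hy]]] := incomparable_gall ay by_ nab nba.
have hh := inner_unique g g' ia ia'; rewrite -hh in hy.
have /and4P[_ ah _ nah] := ia.
by have := am h; rewrite /common_ancestor hx hy ah /= eq_sym (negPf nah).
Qed.

(** * The two sides of a gall *)

Lemma inner_incomparable v h z w x : gall v h -> inner v h z -> z ~> x -> w ~> x ->
  ~~ (z ~> w) -> ~~ (w ~> z) -> inner v h w /\ h ~> x.
Proof.
move=> g iz zx wx nzw nwz.
have [v' [h' [g' iz' iw' hx]]] := incomparable_gall zx wx nzw nwz.
have e := inner_unique g g' iz iz'; rewrite -e in g' iw' hx.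
by rewrite (gall_unique g g').
Qed.

Lemma inner_above v h z w : gall v h -> inner v h z -> w ~> z -> v ~> w -> w != v ->
  inner v h w.
Proof.
move=> g /and4P[vz zh zv nzh] wz vw wv; rewrite /inner vw wv (connect_trans wz zh) /=.
apply: contraNneq nzh => e; rewrite e in wz.
by rewrite (connect_anti zh wz).
Qed.

(* Otherwise [z] would dominate [h]: inner vertices have a single parent, so a
   path from the root can only enter the part of the gall below [z] through [z]. *)
Lemma inner_not_above_both v h z p q : gall v h -> inner v h z -> E p h -> E q h ->
  p != q -> z ~> p -> ~~ (z ~> q).
Proof.
move=> g iz ph qh pq zp; apply/negP => zq.
have := iz; case/and4P=> vz zh zv nzh; have [hh _ _ nd] := g.
have := nd z iz; rewrite negbK => rh.
have nr : ~~ (z ~> r).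
  apply: contraNN zv => zr; have e := connect_anti zr (root_connect z).
  by rewrite -(connect_anti vz _) // e root_connect.
have hr : r != h by apply: contraNneq nr => ->.
have below y : connect (avoid z) r y -> y ~> h -> y != h -> ~~ (z ~> y).
  apply: (connect_forward (P := fun y => y ~> h -> y != h -> ~~ (z ~> y)) (e :=
    avoid z)) => //.
  move=> x w _ IH /and3P[xw xz wz] wh nwh; apply/negP => zw.
  have iw : inner v h w.
    rewrite /inner (connect_trans vz zw) wh nwh andbT.
    by apply: contraNneq zv => e; rewrite e in zw; rewrite (connect_anti vz zw).
  have [|u zu uw] := connect_last zw; first by rewrite eq_sym.
  have eu := inner_one_parent g iw xw uw; rewrite -eu in zu.
  have : ~~ (z ~> x).
    apply: IH; first exact: connect_trans (connect1 xw) wh.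
    apply/eqP => e; rewrite e in xw; exact: (edge_connect_absurd xw wh).
  by rewrite zu.
have [x rx /and3P[xh _ _]] := connect_last rh hr.
have nxh : x != h.
  by apply/eqP => e; rewrite e in xh; apply: (edge_connect_absurd xh (connect0 _ _)).
have nzx := below x rx (connect1 xh) nxh.
(* The path avoiding [z] enters [h] from [x]; as [h] has indegree 2, [x] is [p] or [q], both of
   which are below [z]. *)
have /andP[/eqP h2 _] := hh.
have : [set p; q] = [set u | E u h].
  apply/eqP; rewrite eqEcard cards2 pq -[#|[set u | _]|]/(indeg E h) h2 leqnn andbT.
  by rewrite subUset !sub1set !inE ph qh.
move/setP/(_ x); rewrite !inE xh => /orP[]/eqP e; rewrite e in nzx.
  by rewrite zp in nzx.
by rewrite zq in nzx.
Qed.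

Lemma gall_parents v h : gall v h ->
  exists p q, [/\ E p h, E q h, p != q & forall u, E u h -> u = p \/ u = q].
Proof.
case=> /andP[/cards2P[p [q [pq e]]] _] _ _ _; exists p, q; split=> //.
- by have /setP/(_ p) := e; rewrite !inE eqxx.
- by have /setP/(_ q) := e; rewrite !inE eqxx orbT.
by move=> u uh; have /setP/(_ u) := e; rewrite !inE uh => /esym/orP[]/eqP->; [left|right].
Qed.

Lemma inner_above_parent v h z : gall v h -> inner v h z ->
  exists p, [/\ E p h, z ~> p & inner v h p].
Proof.
move=> g iz; have /and4P[vz zh zv nzh] := iz.
have [p zp ph] := connect_last zh nzh; exists p; split=> //.
rewrite /inner (connect_trans vz zp) connect1 //=; apply/andP; split.
  by apply: contraNneq zv => e; rewrite e in zp; rewrite (connect_anti vz zp).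
by apply/eqP => e; rewrite e in ph; apply: (edge_connect_absurd ph (connect0 _ _)).
Qed.

Lemma inner_chain v h z z' y : gall v h -> inner v h z -> inner v h z' ->
  z ~> y -> z' ~> y -> ~~ (h ~> y) -> (z ~> z') || (z' ~> z).
Proof.
move=> g iz iz' zy z'y nhy; apply: contraR nhy; rewrite negb_or => /andP[n1 n2].
by have [] := inner_incomparable g iz zy z'y n1 n2.
Qed.

Lemma inner_chain_parent v h z z' p : gall v h -> inner v h z -> inner v h z' ->
  E p h -> z ~> p -> z' ~> p -> (z ~> z') || (z' ~> z).
Proof.
move=> g iz iz' ph zp z'p; apply: (inner_chain g iz iz' zp z'p).
by apply/negP => /(edge_connect_absurd ph).
Qed.

(** Since [z] is not above both parents of [h], [a] and [b] reach [h] through the same parent, and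
    the inner vertices above one parent form a chain. *)
Lemma inner_fork v h z a b : gall v h -> inner v h z -> inner v h a -> inner v h b ->
  z ~> a -> z ~> b -> (a ~> b) || (b ~> a).
Proof.
move=> g iz ia ib za zb.
have [p [ph ap _]] := inner_above_parent g ia.
have [q [qh bq _]] := inner_above_parent g ib.
have [pq|pq] := eqVneq p q.
  by rewrite -pq in bq; apply: (inner_chain_parent g ia ib ph).
have := inner_not_above_both g iz ph qh pq (connect_trans za ap).
by rewrite (connect_trans zb bq).
Qed.


(** If [w] is above [c], then [c] is itself a hybrid; otherwise [c] and [w] are incomparable inner
    vertices of some gall. A top other than [v] would make [v] an inner vertex, above both parents
    of the hybrid or above two incomparable inner vertices. *)
Lemma gall_below v c w x : E v c -> v ~> w -> w != v -> ~~ (c ~> w) ->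
  c ~> x -> w ~> x -> exists2 h, gall v h & inner v h w.
Proof.
move=> vc vw wv ncw cx wx; have nvc : v != c.
  by apply/eqP => e; rewrite -e in vc; apply: (edge_connect_absurd vc (connect0 _ _)).
have [wc|nwc] := boolP (w ~> c).
  have nwc : w != c by apply: contraNneq ncw => ->.
  have [u wu uc] := connect_last wc nwc; have vu := connect_trans vw wu.
  have nuv : v != u.
    by apply: contraNneq wv => e; rewrite -e in wu; rewrite (connect_anti vw wu).
  have [v' g] := gall_exists (two_parents_hybrid vc uc nuv).
  have [e|nv] := eqVneq v' v.
    by rewrite e in g; exists c; rewrite // /inner vw wc wv nwc.
  have := gall_parent g vc; rewrite inE => /andP[v'v _].
  have iv : inner v' c v by rewrite /inner v'v connect1 //= eq_sym nv nvc.
  by have := inner_not_above_both g iv vc uc nuv (connect0 _ _); rewrite vu.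
have [v' [h [g ic iw _]]] := incomparable_gall cx wx ncw nwc.
have [e|nv] := eqVneq v' v; first by rewrite e in g iw; exists h.
have /and4P[v'c ch cv _] := ic.
have := interval_parent g v'c cv ch vc; rewrite inE => /andP[v'v _].
have iv : inner v' h v by apply: (inner_above g ic (connect1 vc) v'v); rewrite eq_sym.
have := inner_fork g iv ic iw (connect1 vc) vw.
by rewrite (negPf ncw) (negPf nwc).
Qed.

(** * Inner ancestors and lowest common ancestors *)

Definition inners v h := [set z | inner v h z].

(** This set records where [x] is attached to the gall. It is all of [inners v h] for [x] below [h],
    and possibly for other [x] when [v] is a parent of [h]. *)
Definition inner_anc v h x := [set z | inner v h z && (z ~> x)].

Lemma inner_anc_sub v h x : inner_anc v h x \subset inners v h.
Proof. by apply/subsetP => z; rewrite !inE => /andP[]. Qed.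

Lemma inner_anc_hybrid v h x : inner_anc v h x != inners v h -> ~~ (h ~> x).
Proof.
apply: contraNN => hx; rewrite eqEsubset inner_anc_sub; apply/subsetP => z.
by rewrite !inE => iz; rewrite iz; case/and4P: iz => _ zh _ _; apply: connect_trans zh hx.
Qed.

Lemma inner_anc_nested v h x y :
  {in inner_anc v h x & inner_anc v h y, forall z z', (z ~> z') || (z' ~> z)} ->
  (inner_anc v h x \subset inner_anc v h y) || (inner_anc v h y \subset inner_anc v h x).
Proof.
move=> ch; apply: contraT;
  rewrite negb_or => /andP[/subsetPn[z zx zy] /subsetPn[z' z'y z'x]].
move: (ch z z' zx z'y); move: zx zy z'y z'x.
rewrite !inE => /andP[-> zx] /= nzy /andP[-> z'y] /= nz'x /orP[] c.
  by rewrite (connect_trans c z'y) in nzy.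
by rewrite (connect_trans c zx) in nz'x.
Qed.

(* The side of [x] is the parent of [h] below the gall vertices above [x]. *)
Lemma gall_sides v h : gall v h -> exists side : V -> bool, forall x y,
  inner_anc v h x != set0 -> inner_anc v h y != set0 ->
  inner_anc v h x != inners v h -> inner_anc v h y != inners v h ->
  if side x == side y
  then (inner_anc v h x \subset inner_anc v h y) ||
    (inner_anc v h y \subset inner_anc v h x)
  else inner_anc v h x :&: inner_anc v h y == set0.
Proof.
move=> g; have [p [q [ph qh pq pqU]]] := gall_parents g.
pose side x := [exists z in inner_anc v h x, z ~> p].
(* Any inner ancestor decides the side, because they form a chain and none is above both parents of
   [h]. *)
have sideE x z : inner_anc v h x != inners v h -> z \in inner_anc v h x ->
  side x = (z ~> p).
  move=> /inner_anc_hybrid nhx zx; apply/exists_inP/idP => [[z' z'x z'p]|]; last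
    by exists z.
  move: zx z'x; rewrite !inE => /andP[iz zx] /andP[iz' z'x].
  case/orP: (inner_chain g iz iz' zx z'x nhx) => c; first exact: connect_trans c z'p.
  have [u [uh zu _]] := inner_above_parent g iz.
  case: (pqU u uh) => e; first by rewrite -e.
  have := inner_not_above_both g iz' ph qh pq z'p.
  by rewrite -e (connect_trans c zu).
exists side => x y x0 y0 xZ yZ; case: eqP => s; last first.
  apply/eqP/setP => z; rewrite in_setI in_set0; apply/negP => /andP[zx zy].
  by case: s; rewrite (sideE x z) // (sideE y z).
apply: inner_anc_nested => z z' zx z'y.
have ez : (z ~> p) = (z' ~> p) by rewrite -(sideE x) // -(sideE y).
have iz : inner v h z by move: zx; rewrite inE => /andP[].
have iz' : inner v h z' by move: z'y; rewrite inE => /andP[].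
have [u [uh zu _]] := inner_above_parent g iz.
have [u' [u'h z'u _]] := inner_above_parent g iz'.
case: (boolP (z ~> p)) => zp.
  by apply: (inner_chain_parent g iz iz' ph zp); rewrite -ez.
have zp' := zp; rewrite ez in zp'.
have uq : u = q by case: (pqU u uh) => // e; rewrite -e zu in zp.
have u'q : u' = q by case: (pqU u' u'h) => // e; rewrite -e z'u in zp'.
by rewrite uq in zu; rewrite u'q in z'u; apply: (inner_chain_parent g iz iz' qh).
Qed.

(** A common ancestor strictly below [v] would be inner, whether it is comparable with an inner
    ancestor [z] of [x] or not, unless it is below [z]; but then [z] would be a common inner
    ancestor. *)
Lemma lca_disjoint v h x y : gall v h -> v ~> x -> v ~> y -> inner_anc v h x != set0 ->
  inner_anc v h x :&: inner_anc v h y = set0 -> is_lca E x y v.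
Proof.
move=> g vx vy /set0Pn[z zx] dxy; rewrite /is_lca /common_ancestor vx vy /=.
apply/forallP => b; apply/implyP => /andP[/andP[bx by_] vb]; apply/contraT => bv.
have no u : inner v h u -> u ~> x -> u ~> y -> False.
  by move=> iu ux uy; have /setP/(_ u) := dxy; rewrite !inE iu ux uy.
move: zx; rewrite inE => /andP[iz zx].
have nzb : ~~ (z ~> b) by apply/negP => zb; apply: (no z) => //;
  apply: connect_trans zb by_.
have nbz : ~~ (b ~> z).
  by apply/negP => bz; apply: (no b) => //; apply: (inner_above g iz).
have [ib _] := inner_incomparable g iz zx bx nzb nbz.
by case: (no b).
Qed.

(** A common ancestor [b] strictly below [z] cannot be inner. Take an inner ancestor [u] of [y] that
    is not above [x]: comparing [b] with [u] contradicts this in each case. *)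
Lemma lca_nested v h x y z : gall v h -> z \in inner_anc v h x ->
  (forall u, u \in inner_anc v h x -> u ~> z) ->
  inner_anc v h x \proper inner_anc v h y -> is_lca E x y z.
Proof.
move=> g zx zm /properP[/subsetP sxy [u uy ux]].
have := sxy z zx; move: (zx); rewrite !inE => /andP[iz cx] /andP[_ cy].
rewrite /is_lca /common_ancestor cx cy /=.
apply/forallP => b; apply/implyP => /andP[/andP[bx by_] zb]; apply/contraT => nbz.
have nib : inner v h b -> False.
  move=> ib; have bz : b ~> z by apply: zm; rewrite inE ib.
  by rewrite (connect_anti bz zb) eqxx in nbz.
move: uy ux; rewrite !inE => /andP[iu uy]; rewrite iu /= => nux.
have nub : ~~ (u ~> b) by apply: contraNN nux => ub; apply: connect_trans ub bx.
have nbu : ~~ (b ~> u).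
  apply/negP => bu; case: nib; have /and4P[vz _ zv _] := iz.
  apply: (inner_above g iu bu (connect_trans vz zb)).
  by apply: contraNneq zv => e; rewrite e in zb; rewrite (connect_anti vz zb).
by have [ib _] := inner_incomparable g iu uy by_ nub nbu; case: nib.
Qed.

Lemma inner_anc_bottom v h x : gall v h -> inner_anc v h x != set0 ->
  inner_anc v h x != inners v h ->
  exists2 z, z \in inner_anc v h x & forall u, u \in inner_anc v h x -> u ~> z.
Proof.
move=> g /set0Pn[z0 z0x] /inner_anc_hybrid nhx.
case: (@arg_minnP _ z0 (mem (inner_anc v h x)) ndesc z0x) => z zx zm; exists z => // u ux.
move: (zx) (ux); rewrite !inE => /andP[iz cx] /andP[iu cu].
case/orP: (inner_chain g iz iu cx cu nhx) => // zu.
have [->|nzu] := eqVneq z u; first exact: connect0.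
by have := zm u ux; rewrite leqNgt ndesc_lt.
Qed.

(** * Adjacency of leaves and the collapse of a galled-tree *)

Variable t : V -> label.
Notation W := {x : V | x \in X}.
Notation edge := (@explained_edge V E X t).

Lemma edge_lca (x y : W) a : x != y -> is_lca E (val x) (val y) a ->
  edge x y = is_L1 (t a).
Proof.
move=> xy la; rewrite /explained_edge /= xy /=;
  apply/existsP/idP => [[b /andP[lb tb]]|ta].
  by rewrite (is_lca_unique la lb).
by exists a; rewrite la.
Qed.

(** This supplies [tau] for [coll_polar]. The default [false] is taken only by sets without a lowest
    element. *)
Definition bottom_label (A : {set V}) : bool :=
  if [pick z in A | [forall u in A, u ~> z]] is Some z then is_L1 (t z) else false.

Lemma bottom_labelE (A : {set V}) z : z \in A -> (forall u, u \in A -> u ~> z) ->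
  bottom_label A = is_L1 (t z).
Proof.
move=> zA zm; rewrite /bottom_label; case: pickP => [b /andP[bA /forall_inP bm]|/(_ z)].
  by rewrite (connect_anti (bm z zA) (zm b bA)).
by rewrite zA /= => /forall_inP[].
Qed.

Lemma edge_nested v h (x y : W) : gall v h -> x != y -> inner_anc v h (val x) != set0 ->
  inner_anc v h (val x) \proper inner_anc v h (val y) ->
  edge x y = bottom_label (inner_anc v h (val x)).
Proof.
move=> g xy x0 sxy; have [|z zx zm] := inner_anc_bottom g x0.
  rewrite eqEsubset inner_anc_sub; apply: contraTN sxy => sZ;
    rewrite properE negb_and negbK.
  by rewrite orbC (subset_trans (inner_anc_sub _ _ _) sZ).
by rewrite (bottom_labelE zx zm) (edge_lca xy (lca_nested g zx zm sxy)).
Qed.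

Lemma edge_disjoint v h (x y : W) : gall v h -> x != y -> v ~> val x -> v ~> val y ->
  inner_anc v h (val x) != set0 ->
  inner_anc v h (val x) :&: inner_anc v h (val y) = set0 -> edge x y = is_L1 (t v).
Proof. by move=> g xy vx vy x0 dxy; apply: edge_lca xy (lca_disjoint g vx vy x0 dxy). Qed.

Lemma leaf_connect (x : W) y : val x ~> y -> y = val x.
Proof.
move=> xy; apply/eqP/contraT; rewrite eq_sym => /(connect_first xy)[c xc _].
have /EN2[/eqP] := valP x; rewrite cards_eq0 => /eqP/setP/(_ c).
by rewrite !inE xc.
Qed.

(** Leaves with the same inner ancestors form a module, which is a proper subset because no inner
    vertex is above all of [S]. A transversal fits [coll_polar], with [c] a leaf below all inner
    vertices; if there is no such leaf, the two sides give a split. *)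
Lemma coll_gall v h (S : {set W}) : gall v h ->
  (forall x, x \in S -> v ~> val x) ->
  (forall z, inner v h z -> exists2 x, x \in S & ~~ (z ~> val x)) ->
  (forall x, x \in S -> inner_anc v h (val x) != set0) ->
  (forall A : {set W}, A \proper S -> coll 1 A (fun x y => Some (edge x y))) ->
  coll 1 S (fun x y => Some (edge x y)).
Proof.
move=> g vS nS phi0 IH; pose phi (x : W) := inner_anc v h (val x).
have es : symmetric edge by apply: explained_edge_sym.
have [side0 sP0] := gall_sides g; pose side (x : W) := side0 (val x).
have sP (x y : W) : x \in S -> y \in S -> phi x != inners v h -> phi y != inners v h ->
    if side x == side y then (phi x \subset phi y) || (phi y \subset phi x)
    else phi x :&: phi y == set0.
  by move=> xS yS; apply: sP0; apply: phi0.
have phiZ x : phi x \subset inners v h by apply: inner_anc_sub.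
have [/exists_inP[c0 c0S /eqP c0Z]|/exists_inPn nZ] :=
    boolP [exists x in S, phi x == inners v h]; last first.
  have [/exists_inP[a aS /exists_inP[b bS sab]]|/exists_inPn nab] :=
      boolP [exists x in S, exists y in S, side x != side y].
    apply: coll_split => //; exists [set x in S | side x == side a], (is_L1 (t v)); split.
    - by apply/subsetP => x; rewrite inE => /andP[].
    - by apply/set0Pn; exists a; rewrite inE aS eqxx.
    - by apply/set0Pn; exists b; rewrite !inE bS eq_sym (negPf sab).
    move=> x y; rewrite !inE => /andP[xS /eqP sx] /andP[+ yS]; rewrite yS /= => sy.
    have nsxy : side x != side y by rewrite sx eq_sym.
    have xy : x != y by apply: contraNneq nsxy => ->.
    apply: (edge_disjoint g xy); rewrite ?vS ?phi0 //.
    by have := sP x y xS yS (nZ x xS) (nZ y yS); rewrite (negPf nsxy) => /eqP.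
  have [S0|/set0Pn[x0 x0S]] := eqVneq S set0; first by rewrite S0; apply: coll_small;
    rewrite cards0.
  (* All leaves are on one side, where the sets [phi] are nested; an element of the smallest one
     would be above all of [S]. *)
  case: (@arg_minnP _ x0 (mem S) (fun x => #|phi x|) x0S) => x xS xm.
  have /set0Pn[z zx] := phi0 x xS.
  have iz : inner v h z by move: zx; rewrite inE => /andP[].
  have [y yS nzy] := nS z iz.
  have sxy : side x = side y.
    by have /exists_inPn/(_ y yS) := nab x xS; rewrite negbK => /eqP.
  have := sP x y xS yS (nZ x xS) (nZ y yS); rewrite sxy eqxx => c.
  have /subsetP/(_ z zx) : phi x \subset phi y.
    case/orP: c => // c; have /eqP-> // : phi y == phi x.
    by rewrite eqEcard c; apply: xm.
  by rewrite inE iz (negPf nzy).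
have tri x y : x \in S -> y \in S -> phi x != phi y ->
    [\/ phi x :&: phi y = set0, phi x \proper phi y | phi y \proper phi x].
  move=> xS yS nxy; have [xZ|xZ] := eqVneq (phi x) (inners v h).
    by apply: Or33; rewrite properEneq eq_sym nxy xZ phiZ.
  have [yZ|yZ] := eqVneq (phi y) (inners v h).
    by apply: Or32; rewrite properEneq nxy yZ phiZ.
  have := sP x y xS yS xZ yZ; case: ifP => _; last by move/eqP=> ?; apply: Or31.
  case/orP=> c; first by apply: Or32; rewrite properEneq nxy.
  by apply: Or33; rewrite properEneq eq_sym nxy.
have eprop x y : x \in S -> phi x \proper phi y -> edge x y = bottom_label (phi x).
  move=> xS sxy; apply: (edge_nested g _ _ sxy); last exact: phi0.
  by apply: contraTneq sxy => ->; rewrite properxx.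
have edis x y : x \in S -> y \in S -> phi x :&: phi y = set0 -> edge x y = is_L1 (t v).
  move=> xS yS dxy; apply: (edge_disjoint g _ _ _ _ dxy); rewrite ?vS ?phi0 //.
  by apply: contraTneq (phi0 x xS) => e; rewrite -[inner_anc _ _ _]setIid {2}e dxy eqxx.
apply: (coll_fibres (phi := phi)) => //.
- by move=> x y; rewrite es.
- move=> x x' y xS x'S yS xx' nyx; congr Some.
  have [|c|c|c] := tri x y xS yS; first by rewrite eq_sym.
  + by rewrite !edis // -xx'.
  + by rewrite !eprop -?xx'.
  + by rewrite es (es x') !eprop -?xx'.
- move=> x xS; apply: IH; rewrite properE; apply/andP; split.
    by apply/subsetP => y; rewrite inE => /andP[].
  have /set0Pn[z zx] := phi0 x xS.
  have iz : inner v h z by move: zx; rewrite inE => /andP[].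
  have [y yS nzy] := nS z iz; apply/subsetPn; exists y => //.
  rewrite inE yS /=; apply: contraNneq nzy => e; move: zx; rewrite -/(phi x) -e inE.
  by case/andP.
move=> T /subsetP TS iT sT; have [c cT cZ] := sT c0 c0S; rewrite c0Z in cZ.
have pZ x : x \in T -> x != c -> phi x != inners v h.
  by move=> xT; apply: contraNneq => e; apply/eqP/iT; rewrite // e cZ.
have pne x y : x \in T -> y \in T -> x != y -> phi x != phi y.
  by move=> xT yT; apply: contraNneq => e; apply/eqP/iT.
(* On one side the sets [phi] are nested, and distinct on [T], so cardinality is a strict rank. *)
apply: (@coll_polar _ side (fun x => #|phi x|) (fun x => bottom_label (phi x))
          (is_L1 (t v)) c) => //.
- by move=> x y; rewrite es.
- move=> x y xT yT xc yc sxy; congr Some; apply: edis; rewrite ?TS //; apply/eqP.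
  by have := sP x y (TS x xT) (TS y yT) (pZ x xT xc) (pZ y yT yc); rewrite (negPf sxy).
- move=> x y xT yT xc yc xy sxy; have nxy := pne x y xT yT xy.
  have := sP x y (TS x xT) (TS y yT) (pZ x xT xc) (pZ y yT yc); rewrite sxy eqxx.
  case/orP=> c1; apply: contraNneq nxy => e; first by rewrite eqEcard c1 e leqnn.
  by rewrite eq_sym eqEcard c1 e leqnn.
- move=> x y xT yT xc yc sxy ltxy; congr Some; apply: eprop; first exact: TS.
  have := sP x y (TS x xT) (TS y yT) (pZ x xT xc) (pZ y yT yc); rewrite sxy eqxx.
  rewrite properEcard ltxy andbT => /orP[] // /subset_leq_card.
  by rewrite leqNgt ltxy.
move=> x xT xc _; congr Some; apply: eprop; first exact: TS.
by rewrite cZ properEneq phiZ (pZ x xT xc).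
Qed.

Lemma coll_explained (S : {set W}) : coll 1 S (fun x y => Some (edge x y)).
Proof.
have [n] := ubnP #|S|; elim: n S => // n IHn S ltS.
have IH (A : {set W}) : A \proper S -> coll 1 A (fun x y => Some (edge x y)).
  by move=> /proper_card AS; apply: IHn; apply: leq_trans AS _.
have es : symmetric edge by apply: explained_edge_sym.
have [S1|/card_gt1P[x0 [x1 [x0S x1S x01]]]] := leqP #|S| 1; first exact: coll_small.
pose P v := [forall x in S, v ~> val x].
have Pr : P r by apply/forall_inP => x _; apply: root_connect.
(* By minimality every vertex strictly below [v] misses some element of [S]. *)
case: (arg_minnP ndesc Pr) => v /forall_inP vS vm.
have below c : v ~> c -> c != v -> exists2 x, x \in S & ~~ (c ~> val x).
  move=> vc cv; apply/forall_inPn; apply: contraNN cv => Pc.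
  by apply/contraT => cv; have := vm c Pc; rewrite leqNgt ndesc_lt // eq_sym.
have vx0 : v != val x0.
  apply: contraNneq x01 => e; have := vS x1 x1S; rewrite e => /leaf_connect/val_inj->.
  by [].
have [c vc cx0] := connect_first (vS x0 x0S) vx0.
have cv : c != v.
  by apply/eqP => e; rewrite e in vc; apply: (edge_connect_absurd vc (connect0 _ _)).
have [y0 y0S ncy0] := below c (connect1 vc) cv.
pose D := [set x in S | c ~> val x].
have [/forall_inP hD|] :=
  boolP [forall x in D, forall y in S :\: D, edge x y == is_L1 (t v)].
  apply: coll_split => //; exists D, (is_L1 (t v)); split.
  - by apply/subsetP => x; rewrite inE => /andP[].
  - by apply/set0Pn; exists x0; rewrite inE x0S.
  - by apply/set0Pn; exists y0; rewrite !inE y0S (negPf ncy0).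
  by move=> x y xD yD; have /forall_inP/(_ y yD)/eqP := hD x xD.
case/forall_inPn=> x; rewrite inE => /andP[xS cx] /forall_inPn[y].
rewrite !inE => /andP[+ yS]; rewrite yS /= => ncy nexy.
have xy : x != y by apply: contraNneq ncy => <-.
(* As the adjacency of [x] and [y] disagrees with the label of [v], their lowest common ancestor is
   not [v]. *)
have [w [wx wy vw wv]] : exists w, [/\ w ~> val x, w ~> val y, v ~> w & w != v].
  have : ~~ is_lca E (val x) (val y) v by apply: contraNN nexy => /(edge_lca xy)->.
  rewrite /is_lca /common_ancestor !vS //= => /forallPn[w].
  by rewrite negb_imply => /andP[/andP[/andP[wx wy] vw] wv]; exists w.
have ncw : ~~ (c ~> w) by apply: contraNN ncy => cw; apply: connect_trans cw wy.
have [h g iw] := gall_below vc vw wv ncw cx wx.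
pose M := [set x in S | inner_anc v h (val x) != set0].
have [MS|MS] := eqVneq (S :\: M) set0.
  apply: (coll_gall g vS) => // [z /and4P[vz _ zv _]|a aS]; first exact: below.
  by have /setP/(_ a) := MS; rewrite !inE aS /= andbT negbK => ->.
(* Elements of [S] outside [M] have no inner ancestor, so their lowest common ancestor with any
   element of [M] is [v]. *)
apply: coll_split => //; exists M, (is_L1 (t v)); split=> //.
- by apply/subsetP => a; rewrite inE => /andP[].
- apply/set0Pn; exists x; rewrite inE xS; apply/set0Pn; exists w.
  by rewrite inE iw.
move=> a b; rewrite !inE => /andP[aS a0] /andP[+ bS]; rewrite bS /= negbK => /eqP b0.
apply: (edge_disjoint g); rewrite ?vS //; last by rewrite b0 setI0.
by apply: contraNneq a0 => ->; rewrite b0.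
Qed.

End Network.

(** * Twin-width of GaTEx graphs *)

Lemma labeled_galled_tree_coll (V : finType) (E : rel V) (X : {set V}) (t : V -> label) :
  labeled_galled_tree E X t ->
  coll 1 [set: {x : V | x \in X}] (fun x y => Some (explained_edge E t x y)).
Proof.
case=> [[_ Eac [[x [_ eX _]]|[[r [rU _]] EN2 EN3 EN4]]] _].
  by apply: coll_small; rewrite cardsT card_sig eX cards1.
exact: (coll_explained Eac rU).
Qed.

Lemma GaTEx_collapsible (G : sgraph) : GaTEx G -> collapsible 1 G.
Proof.
case=> V [E [X [t [lt [f [f' fK f'K] fe]]]]].
apply: (coll_collapsible (f := f) (e := explained_edge E t)).
- exact: can_inj fK.
- by move=> x y; rewrite -fe.
suff -> : f @: G = [set: {x : V | x \in X}] by apply: labeled_galled_tree_coll.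
by apply/setP => x; rewrite inE -[x]f'K imset_f.
Qed.

Theorem mainTheorem18 (G : sgraph) :
  GaTEx G -> tww G <= 1 /\ (tww G = 1 <-> ~ cograph G).
Proof.
move=> /GaTEx_collapsible/tww_le le1; split=> //; split=> [e /tww0_cograph|nc].
  by rewrite e.
by case: (tww G) le1 (tww0_cograph G) => [|[|//]] // _ [/(_ erefl)].
Qed.
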